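(* Let $\Omega\subset\mathbb{C}$ be an open connected set, and let $f,g$ be holomorphic functions on $\Omega$. Let $\alpha\in\mathbb{R}$ with $\alpha\notin\pi\mathbb{Q}$, let $I\subset\Omega$ be a line segment (of positive length), let $I_\alpha$ be the image of $I$ under the rotation by angle $\alpha$ about the midpoint of $I$, and suppose that $I_\alpha\subset\Omega$. Suppose that $$|f(z)|=|g(z)|\qquad\text{for all } z\in I\cup I_\alpha .$$ Then there exists $c\in\mathbb{C}$ with $|c|=1$ such that $g(z)=cf(z)$ for all $z\in\Omega$.
   Context: If $p$ is the midpoint of $I$, then $I_\alpha=\{p+e^{i\alpha}(z-p): z\in I\}$. Here $\pi\mathbb{Q}=\{\pi q: q\in\mathbb{Q}\}$. *)

(* Defs.v *)
From Stdlib Require Import Reals QArith Qreals.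
From Coquelicot Require Import Coquelicot.

Open Scope R_scope.

(* Connectedness of a subset for the subspace topology: the set is not covered
   by two open sets that both meet it and whose traces on it are disjoint. *)
Definition connected {T : UniformSpace} (D : T -> Prop) : Prop :=
  forall U V : T -> Prop,
    open U -> open V ->
    (forall x, D x -> U x \/ V x) ->
    (exists x, D x /\ U x) ->
    (exists x, D x /\ V x) ->
    exists x, D x /\ U x /\ V x.

(* Taking [K := C_AbsRing] makes [ex_derive] complex differentiability.  The
   functions are total on [C], but only their values on the open set [D]
   matter. *)
Definition holomorphic_on (D : C -> Prop) (f : C -> C) : Prop :=
  forall z : C, D z -> ex_derive (K := C_AbsRing) (V := C_NormedModule) f z.

Definition segment (a b z : C) : Prop :=
  exists t : R, 0 <= t <= 1 /\ z = (RtoC (1 - t) * a + RtoC t * b)%C.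

Definition midpoint (a b : C) : C := ((a + b) / 2)%C.

(* [Cexpi t] is the complex number e^{it}. *)
Definition Cexpi (t : R) : C := (cos t, sin t).

Definition rotation (p : C) (alpha : R) (z : C) : C :=
  (p + Cexpi alpha * (z - p))%C.

Definition rotated_segment (a b : C) (alpha : R) (w : C) : Prop :=
  exists z : C, segment a b z /\ w = rotation (midpoint a b) alpha z.

(* Main.v *)
Require Import Defs.
From Stdlib Require Import Reals QArith Qreals.
From Coquelicot Require Import Coquelicot.
From Stdlib Require Import Lra Lia Wf_nat ClassicalEpsilon.
Open Scope R_scope.

(** Why the theorem holds.  Let [p] be the midpoint of the segment and [u = b - a].
    Unless [f] vanishes identically, it has a leading term [a h^k] at [p], with
    [a <> 0], and so has [g].  Equality of the moduli along the segment forces the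
    orders to agree and the leading coefficients to have the same modulus; so for
    the quotient [c] of the coefficients, [|c| = 1], and [g - c f] vanishes to order
    greater than [k] at [p].  Suppose that it is not identically zero, with leading
    term [d h^m], [m > k].  Comparing [|g|^2] with [|c f|^2] along a ray in the
    direction [w], the first order at which they can differ gives
    [Re (conj (c a w^k) * d w^m) = 0] ([perturbation_orthogonal]).  For [w = u] this
    says that some complex number [W <> 0] is purely imaginary, and for
    [w = e^(i alpha) u] that [W e^(i (m - k) alpha)] is so too.  Then
    [sin ((m - k) alpha) = 0], and [alpha] would be a rational multiple of [PI].

    The argument rests on the dichotomy of [identity_theorem]: a holomorphic
    function on a connected open set vanishes identically or has a leading term at
    every point.  It is derived from bare complex differentiability.  Goursat's
    theorem for rectangles ([goursat]) comes from bisecting the rectangle;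
    Cauchy's formula ([cauchy_formula]) follows by shrinking the contour to the
    pole; and expanding the kernel of that formula finitely many times, with a
    bound on the remainder, shows that [f] vanishes near a point or has a leading
    term there ([vanishing_or_leading_term]). *)

(** * Complex differentiability *)

Lemma holomorphic_on_subset (D E : C -> Prop) (f : C -> C) :
  (forall z, E z -> D z) -> holomorphic_on D f -> holomorphic_on E f.
Proof. intros H Hf z Hz. apply Hf, H, Hz. Qed.

(** The epsilon-delta form of complex differentiability, stated with [Cmod] so
    that the estimates below never mention filters. *)
Lemma ex_derive_C_bound (f : C -> C) (z : C) :
  ex_derive (K := C_AbsRing) (V := C_NormedModule) f z ->
  exists l : C, forall eps, 0 < eps -> exists d, 0 < d /\
    forall w, Cmod (w - z) < d ->
      Cmod (f w - f z - l * (w - z)) <= eps * Cmod (w - z).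
Proof.
  intros [l [_ Hd]]. exists l. intros eps He.
  destruct (Hd z (fun P H => H) (mkposreal eps He)) as [d Hd'].
  exists d. split; [apply cond_pos|]. intros w Hw.
  generalize (Hd' w Hw).
  change (Cmod (f w - f z - (w - z) * l) <= eps * Cmod (w - z) ->
    Cmod (f w - f z - l * (w - z)) <= eps * Cmod (w - z)).
  rewrite (Cmult_comm l). auto.
Qed.

(** [C] carries two normed-module structures over itself, the product one and
    that of an absolute ring; the general rules of differentiation speak of the
    second.  Both have the norm [Cmod], so the derivatives agree. *)
Lemma is_derive_C_regular (f : C -> C) (z l : C) :
  is_derive (K := C_AbsRing) (V := C_NormedModule) f z l <->
  is_derive (K := C_AbsRing) (V := AbsRing_NormedModule C_AbsRing) f z l.
Proof.
  split; intros [_ H]; split; [apply is_linear_scal_l | exact H | apply is_linear_scal_l | exact H].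
Qed.

Lemma holomorphic_on_minus (D : C -> Prop) (f g : C -> C) :
  holomorphic_on D f -> holomorphic_on D g ->
  holomorphic_on D (fun z => f z - g z)%C.
Proof. intros Hf Hg z Hz. apply (ex_derive_minus (K := C_AbsRing) (V := C_NormedModule) f g z);
  auto. Qed.

Lemma holomorphic_on_plus (D : C -> Prop) (f g : C -> C) :
  holomorphic_on D f -> holomorphic_on D g ->
  holomorphic_on D (fun z => f z + g z)%C.
Proof. intros Hf Hg z Hz. apply (ex_derive_plus (K := C_AbsRing) (V := C_NormedModule) f g z);
  auto. Qed.

Lemma holomorphic_on_const (D : C -> Prop) (c : C) : holomorphic_on D (fun _ => c).
Proof. intros z Hz. apply (ex_derive_const (K := C_AbsRing) (V := C_NormedModule) c z). Qed.

Lemma holomorphic_on_id (D : C -> Prop) : holomorphic_on D (fun z => z).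
Proof. intros z Hz. exists (RtoC 1). apply is_derive_C_regular.
exact (is_derive_id (K := C_AbsRing) z). Qed.

Lemma holomorphic_on_mult (D : C -> Prop) (f g : C -> C) :
  holomorphic_on D f -> holomorphic_on D g ->
  holomorphic_on D (fun z => f z * g z)%C.
Proof.
  intros Hf Hg z Hz. destruct (Hf z Hz) as [df Hdf], (Hg z Hz) as [dg Hdg].
  eexists. apply is_derive_C_regular.
  apply is_derive_C_regular in Hdf. apply is_derive_C_regular in Hdg.
  exact (is_derive_mult (K := C_AbsRing) f g z df dg Hdf Hdg Cmult_comm).
Qed.

Lemma neq_of_Cmod_pos (z w : C) : 0 < Cmod (z - w) -> z <> w.
Proof. intros H ->. replace (w - w)%C with (RtoC 0) in H by ring. rewrite Cmod_0 in H. lra. Qed.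

Lemma Cmod_minus_sym (z w : C) : Cmod (z - w) = Cmod (w - z).
Proof. rewrite <- Cmod_opp. f_equal. ring. Qed.

Lemma Cmod_triangle_minus (z w : C) : Cmod z - Cmod w <= Cmod (z - w).
Proof. generalize (Cmod_triangle (z - w) w). replace (z - w + w)%C with z by ring. lra. Qed.

Lemma holomorphic_on_pole (D : C -> Prop) (p : C) :
  (forall z, D z -> z <> p) -> holomorphic_on D (fun z => / (z - p))%C.
Proof.
  intros HD z Hz.
  assert (Hzp : (z - p)%C <> 0) by now apply Cminus_eq_contra, HD.
  set (u := (z - p)%C) in *.
  assert (Hu : 0 < Cmod u) by now apply Cmod_gt_0.
  (* The error term of the inverse is [d^2 / (v u^2)] with [d = v - u]; keeping [v] at
     modulus at least [|u| / 2] makes it [O(d^2)]. *)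
  exists (- / (u * u))%C. split; [apply is_linear_scal_l|].
  intros z' Hz'.
  assert (z = z') as <-. { apply (is_filter_lim_locally_unique (K := C_AbsRing) (V
    := AbsRing_NormedModule C_AbsRing)). exact Hz'. }
  intros eps.
  assert (Hd : 0 < Rmin (Cmod u / 2) (eps * (Cmod u) ^ 3 / 2)).
  { apply Rmin_pos; [lra|]. assert (0 < Cmod u ^ 3) by now apply pow_lt.
    generalize (cond_pos eps). intros.
    assert (0 < eps * Cmod u ^ 3) by now apply Rmult_lt_0_compat. lra. }
  exists (mkposreal _ Hd). intros w Hw.
  change (Cmod (w - z) < Rmin (Cmod u / 2) (eps * (Cmod u) ^ 3 / 2)) in Hw.
  change (Cmod (/ (w - p) - / (z - p) - (w - z) * - / (u * u)) <= eps * Cmod (w - z)).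
  fold u.
  assert (H1 := Rmin_l (Cmod u / 2) (eps * (Cmod u) ^ 3 / 2)).
  assert (H2 := Rmin_r (Cmod u / 2) (eps * (Cmod u) ^ 3 / 2)).
  set (v := (w - p)%C).
  assert (Hv : Cmod u / 2 <= Cmod v).
  { generalize (Cmod_triangle_minus u v). unfold u, v.
    replace (z - p - (w - p))%C with (z - w)%C by ring. rewrite (Cmod_minus_sym z w). fold u. lra. }
  assert (Hv0 : v <> 0) by (apply Cmod_gt_0; lra).
  set (d := (w - z)%C) in *.
  assert (Ed : d = (v - u)%C) by (unfold d, v, u; ring).
  replace (/ v - / u - d * - / (u * u))%C with (d * d * / v * / (u * u))%C
   by (rewrite Ed; field; auto).
  rewrite !Cmod_mult, !Cmod_inv, Cmod_mult; auto using Cmult_neq_0.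
  assert (0 <= Cmod d) by apply Cmod_ge_0.
  assert (Hx : Cmod d <= eps * (Cmod v * (Cmod u * Cmod u))).
  { apply Rle_trans with (eps * (Cmod u / 2 * (Cmod u * Cmod u))).
    - replace (eps * (Cmod u / 2 * (Cmod u * Cmod u))) with (eps * (Cmod u) ^ 3 / 2) by field. lra.
    - apply Rmult_le_compat_l. left; apply cond_pos. apply Rmult_le_compat_r; [nra|lra]. }
  apply Rle_trans with ((eps * (Cmod v * (Cmod u * Cmod u))) * Cmod d * / Cmod v * /
    (Cmod u * Cmod u)).
  - assert (0 < / Cmod v) by (apply Rinv_0_lt_compat; lra).
    assert (0 < / (Cmod u * Cmod u)) by (apply Rinv_0_lt_compat; nra).
    apply Rmult_le_compat_r; [lra|]. apply Rmult_le_compat_r; [lra|].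
    apply Rmult_le_compat_r; lra.
  - right. field. split; lra.
Qed.

(** The form [(/ z) ^ n] rather than [/ z ^ n] is the one in which the Laurent
    kernels below are multiplied out. *)
Lemma holomorphic_on_pole_pow (D : C -> Prop) (p : C) (n : nat) :
  (forall z, D z -> z <> p) -> holomorphic_on D (fun z => (/ (z - p)) ^ n)%C.
Proof.
  intros HD. induction n as [|n IH].
  - exact (holomorphic_on_const D (RtoC 1)).
  - apply (holomorphic_on_mult D (fun z => / (z - p))%C (fun z => (/ (z - p)) ^ n)%C); auto.
    now apply holomorphic_on_pole.
Qed.

Lemma holomorphic_on_continuous (D : C -> Prop) (f : C -> C) (z : C) (eps : R) :
  holomorphic_on D f -> D z -> 0 < eps ->
  exists d, 0 < d /\ forall w, Cmod (w - z) < d -> Cmod (f w - f z) < eps.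
Proof.
  intros Hf Hz He. destruct (ex_derive_C_bound f z (Hf z Hz)) as [l Hl].
  destruct (Hl 1 Rlt_0_1) as [d [Hd H]].
  assert (Hq : 0 < eps / (Cmod l + 2)).
  { apply Rdiv_lt_0_compat; auto. generalize (Cmod_ge_0 l); lra. }
  exists (Rmin d (eps / (Cmod l + 2))). split; [now apply Rmin_pos|].
  intros w Hw.
  assert (H1 := Rmin_l d (eps / (Cmod l + 2))). assert (H2 := Rmin_r d (eps / (Cmod l + 2))).
  specialize (H w (Rlt_le_trans _ _ _ Hw H1)).
  assert (H3 := Cmod_triangle (f w - f z - l * (w - z)) (l * (w - z))).
  replace (f w - f z - l * (w - z) + l * (w - z))%C with (f w - f z)%C in H3 by ring.
  rewrite Cmod_mult in H3. assert (0 <= Cmod l) by apply Cmod_ge_0.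
  assert (0 <= Cmod (w - z)) by apply Cmod_ge_0.
  apply Rle_lt_trans with ((Cmod l + 1) * Cmod (w - z)); [lra|].
  apply Rle_lt_trans with ((Cmod l + 1) * (eps / (Cmod l + 2))).
  - apply Rmult_le_compat_l; lra.
  - apply Rlt_le_trans with ((Cmod l + 2) * (eps / (Cmod l + 2))).
    + apply Rmult_lt_compat_r; lra.
    + right. field. lra.
Qed.

(** * Integration along the boundary of a rectangle *)
Definition horizontal_integral (f : C -> C) (y x0 x1 : R) : C :=
  RInt (V := C_R_CompleteNormedModule) (fun t => f (t, y)) x0 x1.

Definition vertical_integral (f : C -> C) (x y0 y1 : R) : C :=
  RInt (V := C_R_CompleteNormedModule) (fun t => f (x, t)) y0 y1.

(** The contour integral over the boundary, counterclockwise: [dz] is [dt] on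
    the horizontal sides and [i dt] on the vertical ones. *)
Definition boundary_integral (f : C -> C) (x0 x1 y0 y1 : R) : C :=
  (horizontal_integral f y0 x0 x1 + Ci * vertical_integral f x1 y0 y1
   - horizontal_integral f y1 x0 x1 - Ci * vertical_integral f x0 y0 y1)%C.

Definition rect (x0 x1 y0 y1 : R) (z : C) : Prop :=
  x0 <= Re z <= x1 /\ y0 <= Im z <= y1.

Definition rect_boundary (x0 x1 y0 y1 : R) (z : C) : Prop :=
  rect x0 x1 y0 y1 z /\ (Re z = x0 \/ Re z = x1 \/ Im z = y0 \/ Im z = y1).

(** The isometry hypothesis makes [gamma] continuous into [C] with the topology
    of [Cmod], in which [f] is differentiable; both kinds of sides satisfy it. *)
Lemma ex_RInt_along (f : C -> C) (gamma : R -> C) (a b : R) :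
  (forall s t, Cmod (gamma s - gamma t) = Rabs (s - t)) ->
  a <= b -> (forall t, a <= t <= b -> ex_derive (K := C_AbsRing) (V := C_NormedModule) f
    (gamma t)) ->
  ex_RInt (V := C_R_CompleteNormedModule) (fun t => f (gamma t)) a b.
Proof.
  intros Hg Hab H. apply ex_RInt_continuous. intros t Ht.
  rewrite Rmin_left, Rmax_right in Ht by lra.
  assert (Hc := ex_derive_continuous (K := C_AbsRing) (V := C_NormedModule) f _ (H t Ht)).
  intros P HP. destruct (Hc P HP) as [d Hd]. exists d. intros s Hs. apply Hd.
  change (Cmod (gamma s - gamma t) < d). rewrite Hg. exact Hs.
Qed.

Lemma ex_RInt_horizontal (f : C -> C) (y x0 x1 : R) : x0 <= x1 ->
  holomorphic_on (fun z => x0 <= Re z <= x1 /\ Im z = y) f ->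
  ex_RInt (V := C_R_CompleteNormedModule) (fun t => f (t, y)) x0 x1.
Proof.
  intros Hx Hf. apply (ex_RInt_along f (fun t => (t, y)) x0 x1); [|exact Hx|].
  - intros s t. rewrite <- Cmod_R. f_equal. apply injective_projections; simpl; ring.
  - intros t Ht. apply Hf. split; auto.
Qed.

Lemma ex_RInt_vertical (f : C -> C) (x y0 y1 : R) : y0 <= y1 ->
  holomorphic_on (fun z => Re z = x /\ y0 <= Im z <= y1) f ->
  ex_RInt (V := C_R_CompleteNormedModule) (fun t => f (x, t)) y0 y1.
Proof.
  intros Hy Hf. apply (ex_RInt_along f (fun t => (x, t)) y0 y1); [|exact Hy|].
  - intros s t. rewrite <- Cmod_R, <- (Rmult_1_l (Cmod (RtoC (s - t)))), <- Cmod_Ci,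
    <- Cmod_mult. f_equal.
    apply injective_projections; simpl; ring.
  - intros t Ht. apply Hf. split; auto.
Qed.

(** The integral of a [C]-valued function is linear over [R] by construction;
    linearity over [C] is checked on real and imaginary parts. *)
Lemma RInt_Cmult (c : C) (f : R -> C) (a b : R) :
  ex_RInt (V := C_R_CompleteNormedModule) f a b ->
  RInt (V := C_R_CompleteNormedModule) (fun t => c * f t)%C a b =
  (c * RInt (V := C_R_CompleteNormedModule) f a b)%C.
Proof.
  intros [l Hl].
  rewrite (is_RInt_unique (V := C_R_CompleteNormedModule) _ _ _ _ Hl).
  apply (is_RInt_unique (V := C_R_CompleteNormedModule)).
  assert (H1 := is_RInt_fct_extend_fst (U := R_NormedModule) (V := R_NormedModule) f a b l Hl).
  assert (H2 := is_RInt_fct_extend_snd (U := R_NormedModule) (V := R_NormedModule) f a b l Hl).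
  apply (is_RInt_fct_extend_pair (U := R_NormedModule) (V := R_NormedModule)).
  - apply (is_RInt_minus (V := R_NormedModule) (fun t => fst c * fst (f t)) (fun t
    => snd c * snd (f t))).
    + apply (is_RInt_scal (V := R_NormedModule) _ _ _ (fst c) _ H1).
    + apply (is_RInt_scal (V := R_NormedModule) _ _ _ (snd c) _ H2).
  - apply (is_RInt_plus (V := R_NormedModule) (fun t => fst c * snd (f t)) (fun t => snd c * fst
    (f t))).
    + apply (is_RInt_scal (V := R_NormedModule) _ _ _ (fst c) _ H2).
    + apply (is_RInt_scal (V := R_NormedModule) _ _ _ (snd c) _ H1).
Qed.

Lemma RInt_plus_Cmult (f g : R -> C) (c : C) (a b : R) :
  ex_RInt (V := C_R_CompleteNormedModule) f a b ->
  ex_RInt (V := C_R_CompleteNormedModule) g a b ->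
  ex_RInt (V := C_R_CompleteNormedModule) (fun t => c * g t)%C a b ->
  RInt (V := C_R_CompleteNormedModule) (fun t => f t + c * g t)%C a b =
  (RInt (V := C_R_CompleteNormedModule) f a b + c * RInt (V := C_R_CompleteNormedModule) g a b)%C.
Proof.
  intros Hf Hg Hcg. rewrite <- RInt_Cmult by exact Hg.
  exact (RInt_plus (V := C_R_CompleteNormedModule) f (fun t => c * g t)%C a b Hf Hcg).
Qed.

Lemma Cmod_R_norm (z : C) : norm (V := C_R_CompleteNormedModule) z = Cmod z.
Proof.
  change (sqrt (Rabs (fst z) ^ 2 + Rabs (snd z) ^ 2) = Cmod z).
  unfold Cmod. now rewrite !pow2_abs.
Qed.

Section Rectangle.
Variables x0 x1 y0 y1 : R.
Hypothesis Hx : x0 <= x1.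
Hypothesis Hy : y0 <= y1.

Lemma ex_RInt_boundary (f : C -> C) :
  holomorphic_on (rect_boundary x0 x1 y0 y1) f ->
  ex_RInt (V := C_R_CompleteNormedModule) (fun t => f (t, y0)) x0 x1 /\
  ex_RInt (V := C_R_CompleteNormedModule) (fun t => f (x1, t)) y0 y1 /\
  ex_RInt (V := C_R_CompleteNormedModule) (fun t => f (t, y1)) x0 x1 /\
  ex_RInt (V := C_R_CompleteNormedModule) (fun t => f (x0, t)) y0 y1.
Proof.
  intros Hf.
  split; [|split; [|split]];
    [apply (ex_RInt_horizontal f) | apply (ex_RInt_vertical f) | apply
      (ex_RInt_horizontal f) | apply (ex_RInt_vertical f)];
    try assumption; intros z Hz; apply Hf; unfold rect_boundary, rect; destruct Hz as [H1 H2];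
    rewrite ?H1, ?H2; repeat split; auto; lra.
Qed.

Lemma boundary_integral_ext (f g : C -> C) :
  (forall z, rect_boundary x0 x1 y0 y1 z -> f z = g z) ->
  boundary_integral f x0 x1 y0 y1 = boundary_integral g x0 x1 y0 y1.
Proof.
  intros H. unfold rect_boundary, rect in H.
  assert (Eh : forall y, y = y0 \/ y = y1 -> horizontal_integral f y x0 x1
    = horizontal_integral g y x0 x1).
  { intros y Hyy. apply (RInt_ext (V := C_R_CompleteNormedModule)). intros t.
    rewrite Rmin_left, Rmax_right by lra. intros Ht.
    apply H; simpl; lra. }
  assert (Ev : forall x, x = x0 \/ x = x1 -> vertical_integral f x y0 y1
    = vertical_integral g x y0 y1).
  { intros x Hxx. apply (RInt_ext (V := C_R_CompleteNormedModule)). intros t.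
    rewrite Rmin_left, Rmax_right by lra. intros Ht.
    apply H; simpl; lra. }
  unfold boundary_integral. rewrite (Eh y0), (Eh y1), (Ev x0), (Ev x1) by auto. reflexivity.
Qed.

Lemma boundary_integral_plus_Cmult (f g : C -> C) (c : C) :
  holomorphic_on (rect_boundary x0 x1 y0 y1) f ->
  holomorphic_on (rect_boundary x0 x1 y0 y1) g ->
  boundary_integral (fun z => f z + c * g z)%C x0 x1 y0 y1 =
  (boundary_integral f x0 x1 y0 y1 + c * boundary_integral g x0 x1 y0 y1)%C.
Proof.
  intros Hf Hg.
  assert (Hcg : holomorphic_on (rect_boundary x0 x1 y0 y1) (fun z => c * g z)%C)
    by exact (holomorphic_on_mult _ (fun _ => c) g (holomorphic_on_const _ c) Hg).
  apply ex_RInt_boundary in Hf. apply ex_RInt_boundary in Hg. apply ex_RInt_boundary in Hcg.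
  unfold boundary_integral, horizontal_integral, vertical_integral. rewrite !RInt_plus_Cmult;
    try tauto. ring.
Qed.

Lemma boundary_integral_bound (f : C -> C) (M : R) :
  holomorphic_on (rect_boundary x0 x1 y0 y1) f ->
  (forall z, rect_boundary x0 x1 y0 y1 z -> Cmod (f z) <= M) ->
  Cmod (boundary_integral f x0 x1 y0 y1) <= 2 * M * ((x1 - x0) + (y1 - y0)).
Proof.
  intros Hf HM. apply ex_RInt_boundary in Hf. destruct Hf as (F1 & F2 & F3 & F4).
  assert (B : forall (g : R -> C) a b, a <= b ->
     ex_RInt (V := C_R_CompleteNormedModule) g a b ->
     (forall t, a <= t <= b -> Cmod (g t) <= M) ->
     Cmod (RInt (V := C_R_CompleteNormedModule) g a b) <= (b - a) * M).
  { intros g a b Hab Hg Hb.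
    rewrite <- Cmod_R_norm.
    apply (norm_RInt_le_const (V := C_R_CompleteNormedModule) g a b _ M Hab);
      [|exact (RInt_correct _ _ _ Hg)].
    intros t Ht. rewrite Cmod_R_norm. exact (Hb t Ht). }
  assert (E : forall z : C, rect x0 x1 y0 y1 z ->
     (Re z = x0 \/ Re z = x1 \/ Im z = y0 \/ Im z = y1) -> Cmod (f z) <= M) by (intros; apply HM;
       split; auto).
  apply B in F1; [|lra|intros t Ht; apply E; unfold rect; simpl; auto; lra].
  apply B in F2; [|lra|intros t Ht; apply E; unfold rect; simpl; auto; lra].
  apply B in F3; [|lra|intros t Ht; apply E; unfold rect; simpl; auto; lra].
  apply B in F4; [|lra|intros t Ht; apply E; unfold rect; simpl; auto; lra].
  unfold boundary_integral.
  assert (T : forall a b : C, Cmod (a - b) <= Cmod a + Cmod b).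
  { intros a b. rewrite <- (Cmod_opp b). apply Cmod_triangle. }
  eapply Rle_trans; [apply T|]. eapply Rle_trans; [apply Rplus_le_compat_r, T|].
  eapply Rle_trans; [apply Rplus_le_compat_r, Rplus_le_compat_r, Cmod_triangle|].
  rewrite !Cmod_mult, Cmod_Ci. unfold horizontal_integral, vertical_integral. lra.
Qed.

(** The starting point of Goursat's argument: affine functions have a primitive.
    Here the integrals over opposite sides are simply computed. *)
Lemma boundary_integral_affine (c d : C) : boundary_integral (fun z => c + d * z)%C x0 x1 y0 y1 = 0.
Proof.
  assert (Hid : forall a b, is_RInt (fun t : R => t) a b ((b * b - a * a) / 2)).
  { intros a b. replace ((b * b - a * a) / 2) with (minus (b * b / 2) (a * a / 2)) by
    (unfold minus, plus, opp; simpl; field).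
    apply (is_RInt_derive (fun t => t * t / 2)).
    - intros t _. auto_derive; auto. field.
    - intros t _. apply continuous_id. }
  assert (Hct : forall k a b, is_RInt (fun t : R => k) a b ((b - a) * k)).
  { intros k a b. exact (is_RInt_const (V := R_NormedModule) a b k). }
  rewrite (boundary_integral_plus_Cmult (fun _ => c) (fun z => z) d);
   [|apply holomorphic_on_const|apply holomorphic_on_id].
  assert (E1 : boundary_integral (fun _ => c) x0 x1 y0 y1 = 0).
  { unfold boundary_integral, horizontal_integral, vertical_integral. rewrite !RInt_const.
   unfold scal; simpl; unfold prod_scal, scal, mult; simpl; unfold mult; simpl.
   apply injective_projections; simpl; ring. }
  assert (E2 : boundary_integral (fun z => z) x0 x1 y0 y1 = 0).
  { unfold boundary_integral, horizontal_integral, vertical_integral.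
    rewrite !(fun y a b => is_RInt_unique (V := C_R_CompleteNormedModule) _ a b _
      (is_RInt_fct_extend_pair (U := R_NormedModule) (V := R_NormedModule) (fun t => (t, y)) a b _ _
         (Hid a b) (Hct y a b))).
    rewrite !(fun x a b => is_RInt_unique (V := C_R_CompleteNormedModule) _ a b _
      (is_RInt_fct_extend_pair (U := R_NormedModule) (V := R_NormedModule) (fun t => (x, t)) a b _ _
         (Hct x a b) (Hid a b))).
   apply injective_projections; simpl; field. }
  rewrite E1, E2. ring.
Qed.

End Rectangle.

(** The common side of the two pieces is traversed once in each direction.
    Only differentiability on the boundaries is assumed, so that the cut may pass
    beside a singularity in the interior. *)
Lemma boundary_integral_split_x (f : C -> C) (x0 xm x1 y0 y1 : R) :
  x0 <= xm <= x1 -> y0 <= y1 ->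
  holomorphic_on (rect_boundary x0 xm y0 y1) f -> holomorphic_on (rect_boundary xm x1 y0 y1) f ->
  boundary_integral f x0 x1 y0 y1 = (boundary_integral f x0 xm y0 y1
    + boundary_integral f xm x1 y0 y1)%C.
Proof.
  intros Hx Hy H1 H2. apply ex_RInt_boundary in H1; [|lra..]. apply ex_RInt_boundary in H2;
    [|lra..].
  unfold boundary_integral, horizontal_integral.
  rewrite <- (RInt_Chasles (V := C_R_CompleteNormedModule) (fun t => f (t, y0)) x0 xm x1) by tauto.
  rewrite <- (RInt_Chasles (V := C_R_CompleteNormedModule) (fun t => f (t, y1)) x0 xm x1) by tauto.
  change plus with Cplus. ring.
Qed.

Lemma boundary_integral_split_y (f : C -> C) (x0 x1 y0 ym y1 : R) :
  x0 <= x1 -> y0 <= ym <= y1 ->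
  holomorphic_on (rect_boundary x0 x1 y0 ym) f -> holomorphic_on (rect_boundary x0 x1 ym y1) f ->
  boundary_integral f x0 x1 y0 y1 = (boundary_integral f x0 x1 y0 ym
    + boundary_integral f x0 x1 ym y1)%C.
Proof.
  intros Hx Hy H1 H2. apply ex_RInt_boundary in H1; [|lra..]. apply ex_RInt_boundary in H2;
    [|lra..].
  unfold boundary_integral, vertical_integral.
  rewrite <- (RInt_Chasles (V := C_R_CompleteNormedModule) (fun t => f (x0, t)) y0 ym y1) by tauto.
  rewrite <- (RInt_Chasles (V := C_R_CompleteNormedModule) (fun t => f (x1, t)) y0 ym y1) by tauto.
  change plus with Cplus. ring.
Qed.

(** * Bisection of rectangles *)
Lemma exists_pow2_small (K d : R) : 0 < d -> exists n : nat, K / 2 ^ n < d.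
Proof.
  intros Hd. destruct (Rle_lt_dec K 0) as [HK|HK].
  - exists 0%nat. simpl. lra.
  - destruct (pow_lt_1_zero (1 / 2) ltac:(rewrite Rabs_pos_eq; lra) (d / K)) as [n Hn].
    { now apply Rdiv_lt_0_compat. }
    exists n. specialize (Hn n (le_n n)). rewrite Rabs_pos_eq in Hn by (apply pow_le; lra).
    apply (Rmult_lt_compat_l K) in Hn; auto.
    replace (K * (d / K)) with d in Hn by (field; lra).
    replace ((1 / 2) ^ n) with (/ 2 ^ n) in Hn by (unfold Rdiv; rewrite Rmult_1_l; symmetry;
      apply pow_inv).
    exact Hn.
Qed.

Lemma nested_intervals_point (a b : nat -> R) :
  (forall n, a n <= a (S n)) -> (forall n, b (S n) <= b n) -> (forall n, a n <= b n) ->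
  exists u, forall n, a n <= u <= b n.
Proof.
  intros Ha Hb Hab.
  assert (Ma : forall n k, a n <= a (n + k)%nat).
  { intros n k. induction k as [|k IH]; [rewrite Nat.add_0_r; lra|].
    rewrite Nat.add_succ_r. apply Rle_trans with (1 := IH), Ha. }
  assert (Mb : forall n k, b (n + k)%nat <= b n).
  { intros n k. induction k as [|k IH]; [rewrite Nat.add_0_r; lra|].
    rewrite Nat.add_succ_r. apply Rle_trans with (2 := IH), Hb. }
  assert (Mab : forall m n, a m <= b n).
  { intros m n. apply Rle_trans with (a (m + n)%nat); [apply Ma|].
    apply Rle_trans with (b (m + n)%nat); [apply Hab|]. rewrite Nat.add_comm. apply Mb. }
  destruct (completeness (fun x => exists n, x = a n)) as [u [U1 U2]].
  - exists (b 0%nat). intros x [n ->]. apply Mab.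
  - now exists (a 0%nat), 0%nat.
  - exists u. intros n. split.
    + apply U1. now exists n.
    + apply U2. intros x [m ->]. apply Mab.
Qed.

Record box := Box { box_left : R; box_right : R; box_bottom : R; box_top : R }.

(** The choice made at each step of the bisection below, where [Q] is the
    failure of the property to be proved. *)
Definition bad_quarter (Q : box -> Prop) (s : box) : box :=
  let l := box_left s in let r := box_right s in
  let b := box_bottom s in let t := box_top s in
  let m := (l + r) / 2 in let n := (b + t) / 2 in
  if excluded_middle_informative (Q (Box l m b n)) then Box l m b n else
  if excluded_middle_informative (Q (Box m r b n)) then Box m r b n else
  if excluded_middle_informative (Q (Box l m n t)) then Box l m n t else
  Box m r n t.

(** The compactness argument used twice below: if [P] passes from the quarters
    of a rectangle to the rectangle, and holds for all small rectangles around
    each point, then it holds.  Otherwise some quarter fails, a quarter of that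
    one fails, and so on; the failing rectangles shrink to a point, where the
    local hypothesis contradicts their failure.  The small rectangles contain the
    point [(u, v)] itself: this is what bounds the error of a derivative at
    [(u, v)] by the size of the rectangle. *)
Lemma rect_bisection (P : R -> R -> R -> R -> Prop) (x0 x1 y0 y1 : R) :
  x0 <= x1 -> y0 <= y1 ->
  (forall a b c d, x0 <= a <= b -> b <= x1 -> y0 <= c <= d -> d <= y1 ->
    P a ((a + b) / 2) c ((c + d) / 2) -> P ((a + b) / 2) b c ((c + d) / 2) ->
    P a ((a + b) / 2) ((c + d) / 2) d -> P ((a + b) / 2) b ((c + d) / 2) d -> P a b c d) ->
  (forall u v, x0 <= u <= x1 -> y0 <= v <= y1 -> exists e, 0 < e /\
    forall a b c d, x0 <= a <= u -> u <= b <= x1 -> y0 <= c <= v -> v <= d <= y1 ->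
      b - a < e -> d - c < e -> P a b c d) ->
  P x0 x1 y0 y1.
Proof.
  intros Hx Hy Hsplit Hloc. apply NNPP. intros HP.
  set (Q := fun s => ~ P (box_left s) (box_right s) (box_bottom s) (box_top s)).
  set (s := fun n => Nat.iter n (bad_quarter Q) (Box x0 x1 y0 y1)).
  set (ok := fun s => x0 <= box_left s <= box_right s /\ box_right s <= x1 /\
    y0 <= box_bottom s <= box_top s /\ box_top s <= y1).
  (* A failing rectangle has a failing quarter, of half the width and half the height. *)
  assert (Step : forall t, ok t -> Q t ->
     let t' := bad_quarter Q t in
     Q t' /\ box_left t <= box_left t' <= box_right t' /\ box_right t' <= box_right t /\
      box_bottom t <= box_bottom t' <= box_top t' /\ box_top t' <= box_top t /\
     box_right t' - box_left t' = (box_right t - box_left t) / 2 /\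
      box_top t' - box_bottom t' = (box_top t - box_bottom t) / 2).
  { intros [a b c d] Hok HQ. unfold ok in Hok. simpl in Hok.
    unfold bad_quarter. simpl.
    destruct excluded_middle_informative as [H1|H1]; [split; [exact H1|simpl; lra]|].
    destruct excluded_middle_informative as [H2|H2]; [split; [exact H2|simpl; lra]|].
    destruct excluded_middle_informative as [H3|H3]; [split; [exact H3|simpl; lra]|].
    unfold Q in *. simpl in *. apply NNPP in H1. apply NNPP in H2. apply NNPP in H3.
    split; [|lra]. intros H4. apply HQ. apply Hsplit; auto; tauto || lra. }
  assert (Inv : forall n, ok (s n) /\ Q (s n) /\
     box_right (s n) - box_left (s n) = (x1 - x0) / 2 ^ n /\
     box_top (s n) - box_bottom (s n) = (y1 - y0) / 2 ^ n).
  { induction n as [|n (I1 & I2 & I3 & I4)].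
    - simpl. unfold ok, Q. simpl. repeat split; auto; lra.
    - destruct (Step _ I1 I2) as (S1 & S2 & S3 & S4 & S5 & S6 & S7).
      change (bad_quarter Q (s n)) with (s (S n)) in *.
      unfold ok in *. repeat split; auto; try lra.
      + rewrite S6, I3. simpl. field. apply pow_nonzero; lra.
      + rewrite S7, I4. simpl. field. apply pow_nonzero; lra. }
  assert (Step' : forall n, _) by (intros n; destruct (Inv n) as (I1 & I2 & _);
    exact (Step _ I1 I2)).
  simpl in Step'.
  destruct (nested_intervals_point (fun n => box_left (s n)) (fun n => box_right (s n))) as [u Hu].
  - intros n. apply Step'.
  - intros n. apply Step'.
  - intros n. apply Inv.
  - destruct (nested_intervals_point (fun n => box_bottom (s n)) (fun n => box_top (s n))) as
    [v Hv].
    + intros n. apply Step'.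
    + intros n. apply Step'.
    + intros n. apply Inv.
    + destruct (Hloc u v) as [e [He H]].
      * apply (Hu 0%nat).
      * apply (Hv 0%nat).
      * destruct (exists_pow2_small (Rmax (x1 - x0) (y1 - y0)) e He) as [n Hn].
        destruct (Inv n) as (I1 & I2 & I3 & I4). apply I2.
        assert (0 < / 2 ^ n) by (apply Rinv_0_lt_compat, pow_lt; lra).
        specialize (Hu n). specialize (Hv n). unfold ok in I1.
        assert (M1 := Rmax_l (x1 - x0) (y1 - y0)). assert (M2 := Rmax_r (x1 - x0) (y1 - y0)).
        apply H; try lra.
        -- rewrite I3. apply Rle_lt_trans with (2 := Hn). apply Rmult_le_compat_r; lra.
        -- rewrite I4. apply Rle_lt_trans with (2 := Hn). apply Rmult_le_compat_r; lra.
Qed.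

(** * Goursat's theorem and Cauchy's formula *)
Lemma Cmod_le_sum (z : C) : Cmod z <= Rabs (Re z) + Rabs (Im z).
Proof.
  replace z with (RtoC (Re z) + Ci * RtoC (Im z))%C at 1.
  - eapply Rle_trans; [apply Cmod_triangle|]. rewrite Cmod_mult, Cmod_Ci, !Cmod_R. lra.
  - apply injective_projections; unfold Re, Im, RtoC, Ci; simpl; ring.
Qed.

Lemma rect_Cmod_minus a b c d z w :
  rect a b c d z -> rect a b c d w -> Cmod (z - w) <= (b - a) + (d - c).
Proof.
  intros Hz Hw. eapply Rle_trans; [apply Cmod_le_sum|].
  unfold rect, Re, Im in *. simpl.
  apply Rplus_le_compat; apply Rabs_le; lra.
Qed.

(** By bisection: [f] is bounded near each point, and a common bound for the
    four quarters is a bound for the rectangle. *)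
Lemma holomorphic_on_bounded (x0 x1 y0 y1 : R) (f : C -> C) :
  x0 <= x1 -> y0 <= y1 -> holomorphic_on (rect x0 x1 y0 y1) f ->
  exists M, forall z, rect x0 x1 y0 y1 z -> Cmod (f z) <= M.
Proof.
  intros Hx Hy Hf.
  apply (rect_bisection (fun a b c d => exists M, forall z, rect a b c d z -> Cmod (f z) <= M));
    auto.
  - intros a b c d _ _ _ _ [M1 H1] [M2 H2] [M3 H3] [M4 H4].
    exists (Rmax (Rmax M1 M2) (Rmax M3 M4)). intros z [Hz1 Hz2].
    destruct (Rle_lt_dec (Re z) ((a + b) / 2)), (Rle_lt_dec (Im z) ((c + d) / 2)).
    + apply Rle_trans with (1 := H1 z ltac:(split; lra)). eapply Rle_trans; apply Rmax_l.
    + apply Rle_trans with (1 := H3 z ltac:(split; lra)). eapply Rle_trans;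
      [apply Rmax_l|apply Rmax_r].
    + apply Rle_trans with (1 := H2 z ltac:(split; lra)). eapply Rle_trans;
      [apply Rmax_r|apply Rmax_l].
    + apply Rle_trans with (1 := H4 z ltac:(split; lra)). eapply Rle_trans; apply Rmax_r.
  - intros u v Hu Hv.
    destruct (holomorphic_on_continuous _ f (u, v) 1 Hf (conj Hu Hv) Rlt_0_1) as [d [Hd H]].
    exists (d / 2). split; [lra|]. intros a b c e Ha Hb Hc He H1 H2.
    exists (Cmod (f (u, v)) + 1). intros z Hz.
    assert (B : Cmod (f z - f (u, v)) < 1).
    { apply H. apply Rle_lt_trans with ((b - a) + (e - c)); [|lra].
      apply rect_Cmod_minus; auto. split; simpl; lra. }
    generalize (Cmod_triangle_minus (f z) (f (u, v))). lra.
Qed.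

Lemma le_0_of_le_eps_mult (x K : R) : (forall e, 0 < e -> x <= e * K) -> x <= 0.
Proof.
  intros H. destruct (Rle_lt_dec K 0) as [HK|HK].
  - generalize (H 1 Rlt_0_1). lra.
  - apply Rnot_lt_le. intros Hx.
    assert (Hq : 0 < x / (2 * K)) by (apply Rdiv_lt_0_compat; lra).
    specialize (H _ Hq). replace (x / (2 * K) * K) with (x / 2) in H by (field; lra). lra.
Qed.

Lemma Cmod_le_0 (z : C) : Cmod z <= 0 -> z = 0.
Proof. intros H. apply Cmod_eq_0. generalize (Cmod_ge_0 z). lra. Qed.

(** Bisection applied to the estimate [|integral| <= eps (width + height)^2],
    whose right-hand side is additive under halving.  Near a point, [f] is affine
    up to an error [eps/2 |z - w|]; the affine part integrates to zero, and the
    error, at most [eps/2 (width + height)], is integrated over a contour of length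
    [2 (width + height)]. *)
Theorem goursat (x0 x1 y0 y1 : R) (f : C -> C) :
  x0 <= x1 -> y0 <= y1 -> holomorphic_on (rect x0 x1 y0 y1) f ->
  boundary_integral f x0 x1 y0 y1 = 0.
Proof.
  intros Hx Hy Hf. apply Cmod_le_0.
  apply le_0_of_le_eps_mult with (((x1 - x0) + (y1 - y0)) ^ 2). intros eps He.
  apply (rect_bisection (fun a b c d => Cmod (boundary_integral f a b c d) <= eps * ((b - a) +
    (d - c)) ^ 2)); auto.
  - intros a b c d Ha Hb Hc Hd P1 P2 P3 P4.
    set (m := (a + b) / 2) in *. set (n := (c + d) / 2) in *.
    assert (Hm : a <= m <= b) by (unfold m; lra). assert (Hn : c <= n <= d) by (unfold n; lra).
    assert (Hs : forall a' b' c' d', a <= a' -> b' <= b -> c <= c' -> d' <= d ->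
       holomorphic_on (rect_boundary a' b' c' d') f).
    { intros a' b' c' d' ? ? ? ?. apply holomorphic_on_subset with (2 := Hf).
      intros z [[Hz1 Hz2] _]. split; lra. }
    rewrite (boundary_integral_split_x f a m b c d), (boundary_integral_split_y f a m c n d),
      (boundary_integral_split_y f m b c n d);
      try lra; try (apply Hs; lra).
    assert (T1 := Cmod_triangle (boundary_integral f a m c n + boundary_integral f a m n d)
      (boundary_integral f m b c n + boundary_integral f m b n d)).
    assert (T2 := Cmod_triangle (boundary_integral f a m c n) (boundary_integral f a m n d)).
    assert (T3 := Cmod_triangle (boundary_integral f m b c n) (boundary_integral f m b n d)).
    replace (eps * ((b - a) + (d - c)) ^ 2) with
     (eps * ((m - a) + (n - c)) ^ 2 + eps * ((b - m) + (n - c)) ^ 2 +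
      eps * ((m - a) + (d - n)) ^ 2 + eps * ((b - m) + (d - n)) ^ 2)
     by (unfold m, n; field). lra.
  - intros u v Hu Hv.
    destruct (ex_derive_C_bound f (u, v) (Hf (u, v) (conj Hu Hv))) as [l Hl].
    destruct (Hl (eps / 2)) as [d [Hd H]]; [lra|].
    exists (d / 2). split; [lra|]. intros a b c e Ha Hb Hc He' H1 H2.
    set (w := (u, v) : C) in *.
    set (g := fun z => (f z + (-1) * (f w - l * w + l * z))%C).
    assert (Hfe : holomorphic_on (rect_boundary a b c e) f).
    { apply holomorphic_on_subset with (2 := Hf). intros z [[Hz1 Hz2] _]. split; lra. }
    assert (Ha' : holomorphic_on (rect_boundary a b c e) (fun z => f w - l * w + l * z)%C).
    { apply (holomorphic_on_plus _ (fun _ => f w - l * w)%C (fun z => l * z)%C).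
      - exact (holomorphic_on_const _ _).
      - exact (holomorphic_on_mult _ (fun _ => l) (fun z => z) (holomorphic_on_const _ _)
        (holomorphic_on_id _)). }
    assert (Eg : boundary_integral f a b c e = boundary_integral g a b c e).
    { unfold g. rewrite boundary_integral_plus_Cmult by (auto; lra).
      rewrite boundary_integral_affine by lra. ring. }
    rewrite Eg.
    eapply Rle_trans.
    + apply (boundary_integral_bound a b c e ltac:(lra) ltac:(lra) g (eps / 2 * ((b - a) +
      (e - c)))).
      * apply (holomorphic_on_plus _ f (fun z => -1 * (f w - l * w + l * z))%C Hfe).
        exact (holomorphic_on_mult _ (fun _ => RtoC (-1)) _ (holomorphic_on_const _ _) Ha').
      * intros z [Hz _].
        assert (Hzw : Cmod (z - w) <= (b - a) + (e - c)).
        { apply rect_Cmod_minus; auto. split; simpl; lra. }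
        specialize (H z ltac:(lra)). unfold g.
        replace (f z + -1 * (f w - l * w + l * z))%C with (f z - f w - l * (z - w))%C by ring.
        apply Rle_trans with (1 := H). apply Rmult_le_compat_l; lra.
    + right. field.
Qed.

(** A contour may be replaced by a small square around the only singularity: cut
    off the parts to the left, to the right, below and above the square, over which
    the integral vanishes by Goursat. *)
Lemma boundary_integral_shrink (f : C -> C) (x0 x1 y0 y1 u v e : R) :
  0 < e -> x0 <= u - e -> u + e <= x1 -> y0 <= v - e -> v + e <= y1 ->
  holomorphic_on (fun z => rect x0 x1 y0 y1 z /\ z <> (u, v)) f ->
  boundary_integral f x0 x1 y0 y1 = boundary_integral f (u - e) (u + e) (v - e) (v + e).
Proof.
  intros He H1 H2 H3 H4 Hf.
  assert (Hgo : forall a b c d, x0 <= a <= b -> b <= x1 -> y0 <= c <= d -> d <= y1 ->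
    (b < u \/ u < a \/ d < v \/ v < c) -> boundary_integral f a b c d = 0).
  { intros a b c d ? ? ? ? Hout. apply goursat; try lra. apply holomorphic_on_subset with (2 := Hf).
    intros z [Z1 Z2]. split; [split; lra|]. intros ->. simpl in *. lra. }
  assert (Hed : forall a b c d, x0 <= a <= b -> b <= x1 -> y0 <= c <= d -> d <= y1 ->
    a <> u -> b <> u -> c <> v -> d <> v -> holomorphic_on (rect_boundary a b c d) f).
  { intros a b c d ? ? ? ? ? ? ? ?. apply holomorphic_on_subset with (2 := Hf).
    intros z [[Z1 Z2] Z3]. split; [split; lra|]. intros ->. simpl in *. lra. }
  rewrite (boundary_integral_split_x f x0 (u - e) x1), (boundary_integral_split_x f (u - e) (u
    + e) x1),
    (boundary_integral_split_y f (u - e) (u + e) y0 (v - e) y1), (boundary_integral_split_y f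
      (u - e) (u + e) (v - e) (v + e) y1);
    try lra; try (apply Hed; lra).
  rewrite (Hgo x0 (u - e)), (Hgo (u + e) x1), (Hgo (u - e) (u + e) y0), (Hgo (u - e) (u + e) (v
    + e)); try lra.
  ring.
Qed.

Lemma RInt_shift (g : R -> C) (u a b : R) :
  ex_RInt (V := C_R_CompleteNormedModule) g a b ->
  RInt (V := C_R_CompleteNormedModule) (fun t => g (t - u)) (a + u) (b + u) =
  RInt (V := C_R_CompleteNormedModule) g a b.
Proof.
  intros [l Hl]. rewrite (is_RInt_unique (V := C_R_CompleteNormedModule) _ _ _ _ Hl).
  apply (is_RInt_unique (V := C_R_CompleteNormedModule)).
  apply (is_RInt_ext (V := C_R_CompleteNormedModule) (fun t => scal 1 (g (1 * t + - u)))).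
  - intros t _. transitivity (g (1 * t + - u)); [exact (scal_one (V := C_R_NormedModule) _)|].
    f_equal. ring.
  - apply (is_RInt_comp_lin (V := C_R_CompleteNormedModule) g).
    replace (1 * (a + u) + - u) with a by ring. replace (1 * (b + u) + - u) with b by ring.
    exact Hl.
Qed.

Lemma boundary_integral_translate (f : C -> C) (x0 x1 y0 y1 u v : R) :
  x0 <= x1 -> y0 <= y1 -> holomorphic_on (rect_boundary x0 x1 y0 y1) f ->
  boundary_integral (fun z => f (z - (u, v)))%C (x0 + u) (x1 + u) (y0 + v) (y1 + v)
    = boundary_integral f x0 x1 y0 y1.
Proof.
  intros Hx Hy Hf. apply ex_RInt_boundary in Hf; [|assumption..].
  destruct Hf as (F1 & F2 & F3 & F4).
  assert (Eh : forall y, ex_RInt (V := C_R_CompleteNormedModule) (fun t => f (t, y)) x0 x1 ->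
     horizontal_integral (fun z => f (z - (u, v)))%C (y + v) (x0 + u) (x1 + u)
       = horizontal_integral f y x0 x1).
  { intros y E. unfold horizontal_integral. rewrite <- (RInt_shift (fun t => f (t, y)) u x0 x1 E).
    apply (RInt_ext (V := C_R_CompleteNormedModule)). intros t _. f_equal.
    apply injective_projections; simpl; ring. }
  assert (Ev : forall x, ex_RInt (V := C_R_CompleteNormedModule) (fun t => f (x, t)) y0 y1 ->
     vertical_integral (fun z => f (z - (u, v)))%C (x + u) (y0 + v) (y1 + v)
       = vertical_integral f x y0 y1).
  { intros x E. unfold vertical_integral. rewrite <- (RInt_shift (fun t => f (x, t)) v y0 y1 E).
    apply (RInt_ext (V := C_R_CompleteNormedModule)). intros t _. f_equal.
    apply injective_projections; simpl; ring. }
  unfold boundary_integral. rewrite (Eh y0), (Eh y1), (Ev x0), (Ev x1) by assumption. reflexivity.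
Qed.

(** This is [2 i PI]; the arguments below need only that it is not zero. *)
Definition cauchy_constant : C := boundary_integral Cinv (-1) 1 (-1) 1.

Lemma holomorphic_on_Cinv (D : C -> Prop) : (forall z, D z -> z <> 0) -> holomorphic_on D Cinv.
Proof.
  intros HD z Hz. apply (ex_derive_ext (K := C_AbsRing) (V := C_NormedModule) (fun z => /
    (z - 0))%C).
  - intros t. simpl. f_equal. ring.
  - exact (holomorphic_on_pole D 0 HD z Hz).
Qed.

(** Shrinking both this contour and the one in [cauchy_constant] to squares of
    the same size makes them translates of each other.  Hence the value does not
    depend on the position of the pole. *)
Lemma boundary_integral_simple_pole (x0 x1 y0 y1 u v : R) :
  x0 < u < x1 -> y0 < v < y1 ->
  boundary_integral (fun z => / (z - (u, v)))%C x0 x1 y0 y1 = cauchy_constant.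
Proof.
  intros Hu Hv.
  set (e := Rmin 1 (Rmin (Rmin (u - x0) (x1 - u)) (Rmin (v - y0) (y1 - v)))).
  assert (He : 0 < e <= 1 /\ e <= u - x0 /\ e <= x1 - u /\ e <= v - y0 /\ e <= y1 - v).
  { unfold e, Rmin. repeat destruct Rle_dec; lra. }
  rewrite (boundary_integral_shrink _ x0 x1 y0 y1 u v e); try lra.
  2: { apply holomorphic_on_pole. intros z Hz. apply Hz. }
  unfold cauchy_constant. rewrite (boundary_integral_shrink Cinv (-1) 1 (-1) 1 0 0 e); try lra.
  2: { apply holomorphic_on_Cinv. intros z Hz. apply Hz. }
  rewrite <- (boundary_integral_translate Cinv (0 - e) (0 + e) (0 - e) (0 + e) u v); try lra.
  - f_equal; ring.
  - apply holomorphic_on_Cinv. intros z [_ Hz] ->. simpl in Hz. lra.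
Qed.

(** On each of the four sides the imaginary part of [dz / z] is
    [dt / (t^2 + 1)], so the imaginary part of the integral is positive. *)
Lemma cauchy_constant_neq_0 : cauchy_constant <> 0.
Proof.
  destruct (ex_RInt_boundary (-1) 1 (-1) 1 ltac:(lra) ltac:(lra) Cinv) as (F1 & F2 & F3 & F4).
  { apply holomorphic_on_Cinv. intros z [_ Hz] ->. simpl in Hz. lra. }
  set (g := fun t => / (t * t + 1)).
  assert (Hc : forall t, continuous g t).
  { intros t. apply (ex_derive_continuous (K := R_AbsRing) (V := R_NormedModule) g).
    unfold g. auto_derive. nra. }
  assert (Hg : 0 < RInt g (-1) 1).
  { apply RInt_gt_0; [lra| |].
    - intros t _. apply Rinv_0_lt_compat. nra.
    - intros t _. apply Hc. }
  assert (HI : forall (c : R) (h : R -> C),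
     ex_RInt (V := C_R_CompleteNormedModule) h (-1) 1 ->
     ((forall t, Im (h t) = c * g t) -> Im (RInt (V := C_R_CompleteNormedModule) h (-1) 1)
       = c * RInt g (-1) 1) /\
     ((forall t, Re (h t) = c * g t) -> Re (RInt (V := C_R_CompleteNormedModule) h (-1) 1)
       = c * RInt g (-1) 1)).
  { intros c h [l Hl]. rewrite (is_RInt_unique (V := C_R_CompleteNormedModule) _ _ _ _ Hl).
    assert (E : RInt (fun t => c * g t) (-1) 1 = c * RInt g (-1) 1).
    { apply (RInt_scal (V := R_CompleteNormedModule)).
      apply (ex_RInt_continuous (V := R_CompleteNormedModule)). intros; apply Hc. }
    rewrite <- E. split; intros Hh; symmetry; apply is_RInt_unique.
    - apply (is_RInt_ext (fun t => snd (h t))); [intros; apply Hh|].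
      exact (is_RInt_fct_extend_snd (U := R_NormedModule) (V := R_NormedModule) h _ _ l Hl).
    - apply (is_RInt_ext (fun t => fst (h t))); [intros; apply Hh|].
      exact (is_RInt_fct_extend_fst (U := R_NormedModule) (V := R_NormedModule) h _ _ l Hl). }
  assert (E : Im cauchy_constant = 4 * RInt g (-1) 1).
  { unfold cauchy_constant, boundary_integral, horizontal_integral, vertical_integral.
    destruct (HI 1 _ F1) as [A1 _]. destruct (HI 1 _ F2) as [_ A2].
    destruct (HI (-1) _ F3) as [A3 _]. destruct (HI (-1) _ F4) as [_ A4].
    assert (Q : forall a b c d : C, Im (a + Ci * b - c - Ci * d) = Im a + Re b - Im c - Re d).
    { intros. unfold Im, Re, Ci. simpl. ring. }
    rewrite Q, A1, A2, A3, A4; [ring| | | |];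
    intros t; unfold g, Im, Re, Cinv; simpl; field; nra. }
  intros H. rewrite H in E. unfold Im in E. simpl in E. lra.
Qed.

Lemma square_boundary_dist (u v r : R) (z : C) :
  rect_boundary (u - r) (u + r) (v - r) (v + r) z -> r <= Cmod (z - (u, v)).
Proof.
  intros [[H1 H2] H3]. eapply Rle_trans; [|apply Rmax_Cmod]. simpl.
  destruct (Rle_lt_dec r 0) as [Hr|Hr].
  - apply Rle_trans with 0; auto. eapply Rle_trans; [apply Rabs_pos|apply Rmax_l].
  - unfold Re, Im in *. destruct H3 as [E|[E|[E|E]]].
    + eapply Rle_trans; [|apply Rmax_l]. rewrite E. unfold Rabs. destruct Rcase_abs; lra.
    + eapply Rle_trans; [|apply Rmax_l]. rewrite E. unfold Rabs. destruct Rcase_abs; lra.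
    + eapply Rle_trans; [|apply Rmax_r]. rewrite E. unfold Rabs. destruct Rcase_abs; lra.
    + eapply Rle_trans; [|apply Rmax_r]. rewrite E. unfold Rabs. destruct Rcase_abs; lra.
Qed.

(** The quotient [(f z - f w) / (z - w)] is bounded near [w], so its integral over
    a square of half-side [e] around [w] is [O(e)]; being independent of [e] by
    [boundary_integral_shrink], it is zero. *)
Theorem cauchy_formula (f : C -> C) (x0 x1 y0 y1 u v : R) :
  x0 < u < x1 -> y0 < v < y1 -> holomorphic_on (rect x0 x1 y0 y1) f ->
  boundary_integral (fun z => f z * / (z - (u, v)))%C x0 x1 y0 y1 = (cauchy_constant * f (u, v))%C.
Proof.
  intros Hu Hv Hf. set (w := (u, v) : C).
  set (G := fun z => ((f z - f w) * / (z - w))%C).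
  assert (HG : holomorphic_on (fun z => rect x0 x1 y0 y1 z /\ z <> w) G).
  { apply (holomorphic_on_mult _ (fun z => f z - f w)%C (fun z => / (z - w))%C).
    - apply (holomorphic_on_minus _ f (fun _ => f w)); [|exact (holomorphic_on_const _ _)].
      apply holomorphic_on_subset with (2 := Hf). intros z Hz. apply Hz.
    - apply holomorphic_on_pole. intros z Hz. apply Hz. }
  assert (HG0 : boundary_integral G x0 x1 y0 y1 = 0).
  { destruct (ex_derive_C_bound f w) as [l Hl]; [apply Hf; split; simpl; lra|].
    destruct (Hl 1 Rlt_0_1) as [d [Hd H]].
    (* Points of the square of half-side [e0] are within [4 e0 < d] of [w]. *)
    set (e0 := Rmin (d / 5) (Rmin (Rmin (u - x0) (x1 - u)) (Rmin (v - y0) (y1 - v)))).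
    assert (He0 : 0 < e0 <= d / 5 /\ e0 <= u - x0 /\ e0 <= x1 - u /\ e0 <= v - y0 /\ e0 <= y1 - v).
    { unfold e0, Rmin. repeat destruct Rle_dec; lra. }
    assert (Hl0 := Cmod_ge_0 l).
    apply Cmod_le_0, le_0_of_le_eps_mult with (8 * (Cmod l + 1)). intros e1 He1.
    set (e := Rmin e1 e0).
    assert (He : 0 < e /\ e <= e1 /\ e <= e0).
    { unfold e, Rmin. destruct Rle_dec; lra. }
    assert (Hsub : forall z, rect_boundary (u - e) (u + e) (v - e) (v + e) z
      -> rect x0 x1 y0 y1 z /\ z <> w).
    { intros z [[Z1 Z2] Z3]. split; [split; lra|]. intros ->. simpl in *. lra. }
    rewrite (boundary_integral_shrink G x0 x1 y0 y1 u v e); try lra; [|exact HG].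
    eapply Rle_trans.
    - apply boundary_integral_bound with (M := Cmod l + 1); [lra|lra| |].
      + apply holomorphic_on_subset with (2 := HG). exact Hsub.
      + intros z Hz. unfold G. destruct (Hsub z Hz) as [_ Hzw].
        assert (Hp : 0 < Cmod (z - w)) by now apply Cmod_gt_0, Cminus_eq_contra.
        rewrite Cmod_mult, Cmod_inv by now apply Cminus_eq_contra.
        apply Rmult_le_reg_r with (Cmod (z - w)); auto.
        rewrite Rmult_assoc, Rinv_l, Rmult_1_r by lra.
        assert (B : Cmod (z - w) < d).
        { apply Rle_lt_trans with ((u + e - (u - e)) + (v + e - (v - e))); [|lra].
          apply rect_Cmod_minus; [apply Hz|split; simpl; lra]. }
        specialize (H z B).
        assert (T := Cmod_triangle (f z - f w - l * (z - w)) (l * (z - w))).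
        replace (f z - f w - l * (z - w) + l * (z - w))%C with (f z - f w)%C in T by ring.
        rewrite Cmod_mult in T. lra.
    - replace (2 * (Cmod l + 1) * (u + e - (u - e) + (v + e - (v - e)))) with (e * (8 * (Cmod l
      + 1))) by ring.
      apply Rmult_le_compat_r; lra. }
  assert (Hpole : holomorphic_on (rect_boundary x0 x1 y0 y1) (fun z => / (z - w))%C).
  { apply holomorphic_on_pole. intros z [_ Hz] ->. simpl in Hz. lra. }
  rewrite (boundary_integral_ext x0 x1 y0 y1 ltac:(lra) ltac:(lra) _ (fun z => G z + f w * /
    (z - w))%C).
  - rewrite boundary_integral_plus_Cmult; try lra; auto.
    + rewrite HG0. unfold w at 2. rewrite boundary_integral_simple_pole by lra. fold w. ring.
    + apply holomorphic_on_subset with (2 := HG). intros z Hz. split; [apply Hz|].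
      intros ->. destruct Hz as [_ Hz]. simpl in Hz. lra.
  - intros z _. unfold G. ring.
Qed.

(** * Leading terms of holomorphic functions *)
(** [a] may be zero: then the statement is only that [f] vanishes to order
    greater than [k] at [p]. *)
Definition leading_term (f : C -> C) (p : C) (k : nat) (a : C) : Prop :=
  exists M r, 0 < r /\
    forall h, Cmod h < r -> Cmod (f (p + h) - a * h ^ k)%C <= M * Cmod h ^ S k.

(** Up to the factor [cauchy_constant], [coef n] is the [n]-th Taylor coefficient
    of [f] at [p], and [h ^ n * rest n h] is the remainder after [n] terms in
    Cauchy's integral form.  Expanding the kernel
    [1 / (z - p - h) = 1 / (z - p) + h / ((z - p) (z - p - h))] one step at a time
    avoids any infinite series. *)
Section Expansion.
Variables (f : C -> C) (u v r : R).
Hypothesis Hr : 0 < r.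
Hypothesis Hf : holomorphic_on (rect (u - r) (u + r) (v - r) (v + r)) f.
Let p : C := (u, v).

Let coef (n : nat) : C :=
  boundary_integral (fun z => f z * (/ (z - p)) ^ S n)%C (u - r) (u + r) (v - r) (v + r).
Let rest (n : nat) (h : C) : C :=
  boundary_integral (fun z => f z * (/ (z - p)) ^ n * / (z - (p + h)))%C (u - r) (u + r) (v - r)
    (v + r).

Let edge := rect_boundary (u - r) (u + r) (v - r) (v + r).

Lemma edge_dist_center (z : C) : edge z -> r <= Cmod (z - p).
Proof. apply square_boundary_dist. Qed.

Lemma edge_dist (z h : C) : edge z -> r - Cmod h <= Cmod (z - (p + h)).
Proof.
  intros Hz. apply edge_dist_center in Hz.
  replace (z - (p + h))%C with ((z - p) - h)%C by ring.
  generalize (Cmod_triangle_minus (z - p) h). lra.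
Qed.

Lemma coef_integrand_holomorphic n : holomorphic_on edge (fun z => f z * (/ (z - p)) ^ n)%C.
Proof.
  apply (holomorphic_on_mult _ f (fun z => (/ (z - p)) ^ n)%C).
  - apply holomorphic_on_subset with (2 := Hf). intros z Hz; apply Hz.
  - apply holomorphic_on_pole_pow. intros z Hz. apply neq_of_Cmod_pos.
    apply edge_dist_center in Hz. lra.
Qed.

Lemma rest_integrand_holomorphic n h : Cmod h < r ->
  holomorphic_on edge (fun z => f z * (/ (z - p)) ^ n * / (z - (p + h)))%C.
Proof.
  intros Hh.
  apply (holomorphic_on_mult _ (fun z => f z * (/ (z - p)) ^ n)%C (fun z => / (z - (p + h)))%C).
  - apply coef_integrand_holomorphic.
  - apply holomorphic_on_pole. intros z Hz. apply neq_of_Cmod_pos.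
    apply edge_dist with (h := h) in Hz. lra.
Qed.

Lemma rest_step n h : Cmod h < r -> rest n h = (coef n + h * rest (S n) h)%C.
Proof.
  intros Hh. unfold rest, coef.
  rewrite <- boundary_integral_plus_Cmult; try lra;
    [|apply coef_integrand_holomorphic | now apply rest_integrand_holomorphic].
  apply boundary_integral_ext; try lra. intros z Hz.
  assert (H1 : (z - p)%C <> 0).
  { apply Cminus_eq_contra, neq_of_Cmod_pos. apply edge_dist_center in Hz. lra. }
  assert (H2 : (z - (p + h))%C <> 0).
  { apply Cminus_eq_contra, neq_of_Cmod_pos. apply edge_dist with (h := h) in Hz. lra. }
  rewrite Cpow_S.
  replace (/ (z - (p + h)))%C with (/ (z - p) * (1 + h * / (z - (p + h))))%C at 1.
  - ring.
  - field. split; auto.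
Qed.

Lemma rest_0 h : Cmod h < r -> rest 0 h = (cauchy_constant * f (p + h))%C.
Proof.
  intros Hh. destruct h as [s t].
  assert (B := Rmax_Cmod (s, t)). simpl in B.
  assert (B1 := Rmax_l (Rabs s) (Rabs t)). assert (B2 := Rmax_r (Rabs s) (Rabs t)).
  assert (Rabs s < r) by lra. assert (Rabs t < r) by lra.
  assert (- r < s < r) by (apply Rabs_def2 in H; lra).
  assert (- r < t < r) by (apply Rabs_def2 in H0; lra).
  assert (E := cauchy_formula f (u - r) (u + r) (v - r) (v + r) (u + s) (v
    + t) ltac:(lra) ltac:(lra) Hf).
  change ((u + s, v + t) : C) with (p + (s, t))%C in E.
  rewrite <- E. unfold rest. apply boundary_integral_ext; [lra|lra|]. intros z _.
  rewrite Cmult_1_r. reflexivity.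
Qed.

(** On the contour [|z - p| >= r] and [|z - p - h| >= r - |h|]. *)
Lemma rest_bound : exists B, 0 <= B /\ forall n h, Cmod h < r ->
  Cmod (rest n h) <= B * (/ r) ^ n * / (r - Cmod h).
Proof.
  destruct (holomorphic_on_bounded (u - r) (u + r) (v - r) (v
    + r) f ltac:(lra) ltac:(lra) Hf) as [M HM].
  assert (M0 : 0 <= M).
  { apply Rle_trans with (1 := Cmod_ge_0 (f p)). apply HM. unfold p. split; simpl; lra. }
  exists (8 * r * M). split; [nra|]. intros n h Hh.
  unfold rest. eapply Rle_trans.
  - apply boundary_integral_bound with (M := M * (/ r) ^ n * / (r - Cmod h)); [lra|lra| |].
    + exact (rest_integrand_holomorphic n h Hh).
    + intros z Hz.
      assert (D1 := edge_dist_center z Hz). assert (D2 := edge_dist z h Hz).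
      rewrite !Cmod_mult, Cmod_pow, !Cmod_inv by (apply Cmod_gt_0; lra).
      apply Rmult_le_compat.
      * apply Rmult_le_pos; [apply Cmod_ge_0|]. apply pow_le. left. apply Rinv_0_lt_compat; lra.
      * left. apply Rinv_0_lt_compat; lra.
      * apply Rmult_le_compat.
        -- apply Cmod_ge_0.
        -- apply pow_le. left. apply Rinv_0_lt_compat; lra.
        -- apply HM, Hz.
        -- apply pow_incr. split.
           ++ left. apply Rinv_0_lt_compat; lra.
           ++ apply Rinv_le_contravar; lra.
      * apply Rinv_le_contravar; lra.
  - right. ring.
Qed.

Lemma rest_telescope n h : Cmod h < r -> (forall m, (m < n)%nat -> coef m = 0) ->
  (cauchy_constant * f (p + h) = h ^ n * rest n h)%C.
Proof.
  intros Hh. rewrite <- rest_0 by auto. induction n as [|n IH]; intros H.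
  - simpl. ring.
  - rewrite IH by (intros; apply H; lia). rewrite rest_step, H by (auto; lia).
    rewrite Cpow_S. ring.
Qed.

(** If all coefficients vanish then [f (p + h)] equals the remainder for every
    [n], which tends to zero like [(|h| / r)^n].  Otherwise the first coefficient
    that does not vanish gives the leading term. *)
Theorem vanishing_or_leading_term :
  (forall h, Cmod h < r -> f (p + h)%C = 0) \/
  exists (k : nat) (a : C), a <> 0 /\ leading_term f p k a.
Proof.
  destruct rest_bound as [B [B0 HB]].
  destruct (classic (exists k, coef k <> 0)) as [Hk|Hk].
  - right.
    destruct (dec_inh_nat_subset_has_unique_least_element (fun k => coef k <> 0)) as [k
      [[Hk1 Hk2] _]];
      [intros n; apply classic | exact Hk |].
    assert (K0 := cauchy_constant_neq_0).
    assert (Kp : 0 < Cmod cauchy_constant) by now apply Cmod_gt_0.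
    exists k, (coef k / cauchy_constant)%C. split.
    { intros E. apply Hk1. replace (coef k) with (cauchy_constant * (coef k
      / cauchy_constant))%C by now field.
      rewrite E. ring. }
    exists (/ Cmod cauchy_constant * (B * (/ r) ^ S k * / (r - r / 2))), (r / 2). split; [lra|].
    intros h Hh.
    assert (E := rest_telescope k h ltac:(lra)).
    rewrite rest_step in E by lra.
    assert (E' : (f (p + h) - coef k / cauchy_constant * h ^ k = / cauchy_constant * (rest
      (S k) h * h ^ S k))%C).
    { replace (f (p + h)%C) with (/ cauchy_constant * (cauchy_constant * f (p + h)))%C by now field.
      rewrite E, Cpow_S.
      - field. exact K0.
      - intros m Hm. apply NNPP. intros Hc. apply Hk2 in Hc. lia. }
    rewrite E', !Cmod_mult, Cmod_inv, Cmod_pow, Rmult_assoc by exact K0.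
    apply Rmult_le_compat_l; [left; now apply Rinv_0_lt_compat|].
    apply Rmult_le_compat_r; [apply pow_le, Cmod_ge_0|].
    apply Rle_trans with (1 := HB (S k) h ltac:(lra)).
    apply Rmult_le_compat_l.
    + apply Rmult_le_pos; auto. apply pow_le. left. apply Rinv_0_lt_compat; lra.
    + apply Rinv_le_contravar; lra.
  - left. intros h Hh.
    assert (Hz : forall k, coef k = 0) by (intros k; apply NNPP; intros Hc; apply Hk; now exists k).
    assert (E : (cauchy_constant * f (p + h))%C = 0).
    { apply Cmod_le_0. apply le_0_of_le_eps_mult with (B * / (r - Cmod h)). intros eps He.
      assert (Hq : 0 <= Cmod h / r) by (apply Rdiv_le_0_compat; [apply Cmod_ge_0|auto]).
      assert (Hq1 : Cmod h / r < 1).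
      { apply Rmult_lt_reg_r with r; auto. unfold Rdiv. rewrite Rmult_assoc, Rinv_l by lra. lra. }
      destruct (pow_lt_1_zero (Cmod h / r) ltac:(rewrite Rabs_pos_eq; lra) eps He) as [n Hn].
      specialize (Hn n (le_n n)). rewrite Rabs_pos_eq in Hn by (apply pow_le; lra).
      rewrite (rest_telescope n h Hh) by auto. rewrite Cmod_mult, Cmod_pow.
      assert (0 <= / (r - Cmod h)) by (left; apply Rinv_0_lt_compat; lra).
      apply Rle_trans with (Cmod h ^ n * (B * (/ r) ^ n * / (r - Cmod h))).
      - apply Rmult_le_compat_l; [apply pow_le, Cmod_ge_0|]. now apply HB.
      - replace (Cmod h ^ n * (B * (/ r) ^ n * / (r - Cmod h))) with ((Cmod h / r) ^ n * (B * /
        (r - Cmod h))).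
        + apply Rmult_le_compat_r; [|lra]. now apply Rmult_le_pos.
        + unfold Rdiv. rewrite Rpow_mult_distr. ring. }
    replace (f (p + h)%C) with (/ cauchy_constant * (cauchy_constant * f (p + h)))%C by (field;
      apply cauchy_constant_neq_0).
    rewrite E. ring.
Qed.

End Expansion.

(** * The identity theorem *)
Lemma open_contains_square (D : C -> Prop) (u v : R) :
  open (T := C_UniformSpace) D -> D (u, v) ->
  exists r, 0 < r /\ forall z, rect (u - r) (u + r) (v - r) (v + r) z -> D z.
Proof.
  intros HD Hp. destruct (HD (u, v) Hp) as [e He].
  exists (e / 2). assert (H0 := cond_pos e). split; [lra|]. intros z [[H1 H2] [H3 H4]].
  apply He. unfold Re, Im in *. split.
  - change (Rabs (fst z - u) < e). apply Rabs_lt_between; lra.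
  - change (Rabs (snd z - v) < e). apply Rabs_lt_between; lra.
Qed.

Lemma open_of_discs (D : C -> Prop) :
  (forall z, D z -> exists d, 0 < d /\ forall w, Cmod (w - z) < d -> D w) ->
  open (T := C_UniformSpace) D.
Proof.
  intros H z Hz. destruct (H z Hz) as [d [Hd Hw]].
  assert (Hd2 : 0 < d / 2) by lra.
  exists (mkposreal _ Hd2). intros w [B1 B2]. apply Hw.
  apply Rle_lt_trans with (1 := Cmod_le_sum _).
  change (Rabs (fst w - fst z) < d / 2) in B1. change (Rabs (snd w - snd z) < d / 2) in B2.
  change (Rabs (fst w - fst z) + Rabs (snd w - snd z) < d). lra.
Qed.

(** Where [M |h| < |a|], the error [M |h|^(k+1)] is smaller than the modulus
    [|a| |h|^k] of the leading term. *)
Lemma leading_term_isolated (f : C -> C) (p : C) (k : nat) (a : C) :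
  a <> 0 -> leading_term f p k a ->
  exists d, 0 < d /\ forall w, 0 < Cmod (w - p) < d -> f w <> 0.
Proof.
  intros Ha (M & r & Hr & H). apply Cmod_gt_0 in Ha.
  assert (HM := Rabs_pos M). assert (HM' := RRle_abs M).
  assert (Hq : 0 < Cmod a / (Rabs M + 1)) by (apply Rdiv_lt_0_compat; lra).
  exists (Rmin r (Cmod a / (Rabs M + 1))). split; [now apply Rmin_pos|].
  intros w [Hw1 Hw2] E.
  assert (R1 := Rmin_l r (Cmod a / (Rabs M + 1))). assert (R2 := Rmin_r r (Cmod a / (Rabs M + 1))).
  set (h := (w - p)%C) in *. specialize (H h ltac:(lra)).
  replace (p + h)%C with w in H by (unfold h; ring).
  rewrite E in H. replace (0 - a * h ^ k)%C with (- (a * h ^ k))%C in H by ring.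
  rewrite Cmod_opp, Cmod_mult, Cmod_pow in H. simpl in H.
  assert (Hp : 0 < Cmod h ^ k) by now apply pow_lt.
  assert (Hlt : Cmod h * (Rabs M + 1) < Cmod a).
  { apply Rmult_lt_reg_r with (/ (Rabs M + 1)); [apply Rinv_0_lt_compat; lra|].
    rewrite Rmult_assoc, Rinv_r by lra. unfold Rdiv in *. lra. }
  assert (M * Cmod h < Cmod a).
  { apply Rle_lt_trans with (2 := Hlt). rewrite Rmult_comm. apply Rmult_le_compat_l; lra. }
  assert (M * Cmod h * Cmod h ^ k < Cmod a * Cmod h ^ k) by now apply Rmult_lt_compat_r.
  lra.
Qed.

(** By [vanishing_or_leading_term], each point of [Omega] has a disc in which [f]
    vanishes, or a punctured disc in which [f] has no zero.  The two kinds of points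
    form disjoint open sets, and [Omega] is connected. *)
Theorem identity_theorem (Omega : C -> Prop) (f : C -> C) :
  open (T := C_UniformSpace) Omega -> connected (T := C_UniformSpace) Omega ->
  holomorphic_on Omega f ->
  (forall z, Omega z -> f z = 0) \/
  (forall p, Omega p -> exists (k : nat) (a : C), a <> 0 /\ leading_term f p k a).
Proof.
  intros Ho Hc Hf.
  set (U := fun z : C => exists d, 0 < d /\ forall w, Cmod (w - z) < d -> f w = 0).
  set (V := fun z : C => exists d, 0 < d /\ forall w, 0 < Cmod (w - z) < d -> f w <> 0).
  assert (Loc : forall p, Omega p ->
     U p \/ exists (k : nat) (a : C), a <> 0 /\ leading_term f p k a).
  { intros [u v] Hp. destruct (open_contains_square Omega u v Ho Hp) as [r [Hr Hsq]].
    destruct (vanishing_or_leading_term f u v r Hr) as [H|H]; auto.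
    - apply holomorphic_on_subset with (2 := Hf). exact Hsq.
    - left. exists r. split; auto. intros w Hw. rewrite <- (H _ Hw). f_equal. ring. }
  assert (HU : open (T := C_UniformSpace) U).
  { apply open_of_discs. intros z [d [Hd H]]. exists (d / 2). split; [lra|].
    intros w Hw. exists (d / 2). split; [lra|]. intros x Hx. apply H.
    replace (x - z)%C with ((x - w) + (w - z))%C by ring.
    generalize (Cmod_triangle (x - w) (w - z)). lra. }
  assert (HV : open (T := C_UniformSpace) V).
  { apply open_of_discs. intros z [d [Hd H]]. exists d. split; [lra|].
    intros w Hw. destruct (classic (w = z)) as [->|Hwz]; [exists d; auto|].
    assert (P : 0 < Cmod (w - z)) by now apply Cmod_gt_0, Cminus_eq_contra.
    exists (Rmin (Cmod (w - z)) (d - Cmod (w - z))). split; [apply Rmin_pos; lra|].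
    intros x [_ Hx]. apply H.
    assert (R1 := Rmin_l (Cmod (w - z)) (d - Cmod (w - z))).
    assert (R2 := Rmin_r (Cmod (w - z)) (d - Cmod (w - z))).
    assert (T1 := Cmod_triangle (x - w) (w - z)).
    assert (T2 := Cmod_triangle_minus (w - z) (w - x)). rewrite (Cmod_minus_sym w x) in T2.
    replace (w - z - (w - x))%C with (x - z)%C in T2 by ring.
    replace (x - w + (w - z))%C with (x - z)%C in T1 by ring. lra. }
  destruct (classic (forall p, Omega p -> exists (k : nat) (a : C), a <> 0 /\ leading_term f p k a))
    as [H|H]; [now right|left].
  intros z Hz. apply NNPP. intros Hfz. apply not_all_ex_not in H. destruct H as [p Hp].
  apply imply_to_and in Hp. destruct Hp as [Hp Hnp].
  destruct (Hc U V HU HV) as [x [_ [[d1 [Hd1 H1]] [d2 [Hd2 H2]]]]].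
  - intros y Hy. destruct (Loc y Hy) as [L|(k & a & Ha & L)]; [now left|right].
    exact (leading_term_isolated f y k a Ha L).
  - exists p. split; auto. destruct (Loc p Hp); tauto.
  - exists z. split; auto. destruct (Loc z Hz) as [[d [Hd L]]|(k & a & Ha & L)].
    + exfalso. apply Hfz, L. replace (z - z)%C with (RtoC 0) by ring. rewrite Cmod_0. auto.
    + exact (leading_term_isolated f z k a Ha L).
  - set (e := Rmin d1 d2 / 2).
    assert (He : 0 < e < d1 /\ e < d2) by (unfold e, Rmin; destruct Rle_dec; lra).
    assert (Em : Cmod (x + e - x) = e).
    { replace (x + e - x)%C with (RtoC e) by ring. rewrite Cmod_R. apply Rabs_pos_eq. lra. }
    apply (H2 (x + e)%C); [rewrite Em; lra|]. apply H1. rewrite Em. lra.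
Qed.

(** * Comparing moduli along a ray *)
Lemma leading_term_lower (f : C -> C) (p : C) (k m : nat) (a : C) :
  (k < m)%nat -> leading_term f p m a -> leading_term f p k 0.
Proof.
  intros Hkm (M & r & Hr & H). exists (Cmod a + Rabs M), (Rmin 1 r).
  split; [apply Rmin_pos; lra|]. intros h Hh.
  assert (R1 := Rmin_l 1 r). assert (R2 := Rmin_r 1 r).
  specialize (H h ltac:(lra)).
  assert (T := Cmod_triangle (f (p + h) - a * h ^ m)%C (a * h ^ m)%C).
  replace (f (p + h) - a * h ^ m + a * h ^ m)%C with (f (p + h) - 0 * h ^ k)%C in T by ring.
  rewrite Cmod_mult, Cmod_pow in T.
  assert (P : forall n, (S k <= n)%nat -> 0 <= Cmod h ^ n <= Cmod h ^ S k).
  { intros n Hn. split; [apply pow_le, Cmod_ge_0|].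
    replace n with ((S k) + (n - S k))%nat by lia. rewrite pow_add.
    rewrite <- (Rmult_1_r (Cmod h ^ S k)) at 2. apply Rmult_le_compat_l; [apply pow_le, Cmod_ge_0|].
    rewrite <- (pow1 (n - S k)). apply pow_incr. split; [apply Cmod_ge_0|lra]. }
  assert (P1 := P m ltac:(lia)). assert (P2 := P (S m) ltac:(lia)).
  assert (Q1 : Cmod a * Cmod h ^ m <= Cmod a * Cmod h ^ S k) by (apply Rmult_le_compat_l;
    [apply Cmod_ge_0|lra]).
  assert (Q2 : M * Cmod h ^ S m <= Rabs M * Cmod h ^ S k).
  { apply Rle_trans with (Rabs M * Cmod h ^ S m).
    - apply Rmult_le_compat_r; [lra|apply RRle_abs].
    - apply Rmult_le_compat_l; [apply Rabs_pos|lra]. }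
  lra.
Qed.

Lemma leading_term_minus (f g : C -> C) (p c : C) (k : nat) (a b : C) :
  leading_term f p k a -> leading_term g p k b ->
  leading_term (fun z => g z - c * f z)%C p k (b - c * a)%C.
Proof.
  intros (M1 & r1 & Hr1 & H1) (M2 & r2 & Hr2 & H2).
  exists (M2 + Cmod c * M1), (Rmin r1 r2). split; [now apply Rmin_pos|]. intros h Hh.
  assert (R1 := Rmin_l r1 r2). assert (R2 := Rmin_r r1 r2).
  specialize (H1 h ltac:(lra)). specialize (H2 h ltac:(lra)).
  replace (g (p + h) - c * f (p + h) - (b - c * a) * h ^ k)%C with
    ((g (p + h) - b * h ^ k) + (- c) * (f (p + h) - a * h ^ k))%C by ring.
  eapply Rle_trans; [apply Cmod_triangle|]. rewrite Cmod_mult, Cmod_opp.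
  apply (Rmult_le_compat_l (Cmod c)) in H1; [|apply Cmod_ge_0]. lra.
Qed.

(** One constant [M] and one range of [t] serve the leading coefficient, the
    error and the function, so that the estimates below can be combined by plain
    arithmetic. *)
Lemma leading_term_ray (f : C -> C) (p u : C) (k : nat) (a : C) :
  leading_term f p k a ->
  exists M t0, 0 <= M /\ 0 < t0 <= 1 /\ forall t, 0 < t < t0 ->
    Cmod (f (p + t * u) - a * u ^ k * RtoC (t ^ k))%C <= M * t ^ S k /\
    Cmod (f (p + t * u)%C) <= M * t ^ k /\ Cmod a * Cmod u ^ k <= M.
Proof.
  intros (M & r & Hr & H).
  assert (Hu := Cmod_ge_0 u). assert (HM := Rabs_pos M).
  set (M1 := Rabs M * Cmod u ^ S k).
  set (A := Cmod a * Cmod u ^ k).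
  assert (H1 : 0 <= M1) by (apply Rmult_le_pos; auto; now apply pow_le).
  assert (H2 : 0 <= A) by (apply Rmult_le_pos; [apply Cmod_ge_0|now apply pow_le]).
  assert (Hq : 0 < r / (Cmod u + 1)) by (apply Rdiv_lt_0_compat; lra).
  exists (A + M1), (Rmin 1 (r / (Cmod u + 1))). split; [lra|].
  split; [split; [apply Rmin_pos; lra|apply Rmin_l]|].
  intros t Ht. assert (R1 := Rmin_l 1 (r / (Cmod u + 1))).
  assert (R2 := Rmin_r 1 (r / (Cmod u + 1))).
  assert (Et : Cmod (t * u)%C = t * Cmod u) by (rewrite Cmod_mult, Cmod_R, Rabs_pos_eq; lra).
  assert (Hlt : Cmod (t * u)%C < r).
  { rewrite Et. apply Rlt_le_trans with (r / (Cmod u + 1) * (Cmod u + 1)); [nra|right; field;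
    lra]. }
  specialize (H _ Hlt). rewrite Et in H.
  rewrite Cpow_mult_l, <- RtoC_pow in H.
  replace (a * (RtoC (t ^ k) * u ^ k))%C with (a * u ^ k * RtoC (t ^ k))%C in H by ring.
  rewrite Rpow_mult_distr in H.
  assert (Hk : 0 < t ^ k) by (apply pow_lt; lra). assert (HSk : 0 < t ^ S k <= t ^ k) by (simpl;
    nra).
  assert (Hn : Cmod (f (p + t * u) - a * u ^ k * RtoC (t ^ k))%C <= M1 * t ^ S k).
  { apply Rle_trans with (1 := H). unfold M1.
    replace (Rabs M * Cmod u ^ S k * t ^ S k) with (Rabs M * (t ^ S k * Cmod u ^ S k)) by ring.
    apply Rmult_le_compat_r; [|apply RRle_abs]. apply Rmult_le_pos; [lra|now apply pow_le]. }
  split; [|split].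
  - nra.
  - assert (T := Cmod_triangle (f (p + t * u) - a * u ^ k * RtoC (t ^ k))%C (a * u ^ k * RtoC
    (t ^ k))%C).
    replace (f (p + t * u) - a * u ^ k * RtoC (t ^ k) + a * u ^ k * RtoC (t ^ k))%C with (f (p
      + t * u)%C) in T by ring.
    rewrite !Cmod_mult, Cmod_pow, Cmod_R, Rabs_pos_eq in T by lra. fold A in T. nra.
  - fold A. lra.
Qed.

(** A term of order [t^n] cannot be dominated by one of order [t^(n+1)] as [t]
    tends to [0]. *)
Lemma coef_le_0_of_power_bound (A K t0 : R) (n : nat) :
  0 < t0 -> (forall t, 0 < t < t0 -> A * t ^ n <= K * t ^ S n) -> A <= 0.
Proof.
  intros Ht0 H. apply le_0_of_le_eps_mult with (Rabs K). intros e He.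
  set (t := Rmin e (t0 / 2)).
  assert (Ht : 0 < t <= e /\ t < t0) by (unfold t, Rmin; destruct Rle_dec; lra).
  specialize (H t ltac:(lra)). simpl in H.
  assert (Hp : 0 < t ^ n) by (apply pow_lt; lra).
  assert (A <= K * t).
  { apply Rmult_le_reg_r with (t ^ n); auto. lra. }
  assert (K * t <= Rabs K * t) by (apply Rmult_le_compat_r; [lra|apply RRle_abs]).
  assert (Rabs K * t <= Rabs K * e) by (apply Rmult_le_compat_l; [apply Rabs_pos|lra]).
  lra.
Qed.

Definition equal_modulus_ray (f g : C -> C) (p u : C) : Prop :=
  exists t0, 0 < t0 /\ forall t : R, 0 < t < t0 -> Cmod (f (p + t * u)%C) = Cmod (g (p + t * u)%C).

Lemma leading_coef_modulus_le (f g : C -> C) (p u : C) (k : nat) (a b : C) :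
  u <> 0 -> equal_modulus_ray f g p u ->
  leading_term f p k a -> leading_term g p k b -> Cmod a <= Cmod b.
Proof.
  intros Hu (s & Hs & Hfg) Hf Hg.
  destruct (leading_term_ray f p u k a Hf) as (M1 & t1 & HM1 & Ht1 & H1).
  destruct (leading_term_ray g p u k b Hg) as (M2 & t2 & HM2 & Ht2 & H2).
  apply Cmod_gt_0 in Hu. assert (Huk : 0 < Cmod u ^ k) by now apply pow_lt.
  apply Rmult_le_reg_r with (Cmod u ^ k); auto.
  apply Rminus_le. apply coef_le_0_of_power_bound with (M1 + M2) (Rmin s (Rmin t1 t2)) k.
  - repeat apply Rmin_pos; lra.
  - intros t Ht. assert (0 < t < s /\ t < t1 /\ t < t2) as (T0 & T1 & T2).
    { revert Ht. unfold Rmin. repeat destruct Rle_dec; lra. }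
    destruct (H1 t ltac:(lra)) as [B1 _]. destruct (H2 t ltac:(lra)) as [B2 _].
    specialize (Hfg t T0).
    assert (C1 := Cmod_triangle_minus (a * u ^ k * RtoC (t ^ k)) (f (p + t * u)%C)).
    rewrite (Cmod_minus_sym (a * u ^ k * RtoC (t ^ k))) in C1.
    assert (C2 := Cmod_triangle_minus (g (p + t * u)%C) (b * u ^ k * RtoC (t ^ k))).
    assert (0 < t ^ k) by (apply pow_lt; lra).
    rewrite !Cmod_mult, Cmod_pow, Cmod_R, Rabs_pos_eq in C1 by lra.
    rewrite !Cmod_mult, Cmod_pow, Cmod_R, Rabs_pos_eq in C2 by lra.
    lra.
Qed.

(** Were [m] larger than [k], [g] would have coefficient [0] at order [k], and the
    comparison of coefficients would give [a = 0]. *)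
Lemma leading_term_order_le (f g : C -> C) (p u : C) (k m : nat) (a b : C) :
  u <> 0 -> equal_modulus_ray f g p u -> a <> 0 ->
  leading_term f p k a -> leading_term g p m b -> (m <= k)%nat.
Proof.
  intros Hu Hfg Ha Hf Hg. destruct (Nat.le_gt_cases m k) as [|Hkm]; auto. exfalso.
  apply leading_term_lower with (1 := Hkm) in Hg.
  apply Ha, Cmod_le_0. rewrite <- Cmod_0.
  exact (leading_coef_modulus_le f g p u k a 0 Hu Hfg Hf Hg).
Qed.

Lemma leading_term_ray_neq_0 (f : C -> C) (p u : C) (k : nat) (a : C) (s : R) :
  u <> 0 -> a <> 0 -> leading_term f p k a -> 0 < s ->
  ~ (forall t : R, 0 < t < s -> f (p + t * u)%C = 0).
Proof.
  intros Hu Ha Hf Hs H. apply Ha, Cmod_le_0. rewrite <- Cmod_0.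
  apply (leading_coef_modulus_le f (fun _ => 0) p u k a 0 Hu); auto.
  - exists s. split; auto. intros t Ht. now rewrite H.
  - exists 0, 1. split; [lra|]. intros h _. replace (0 - 0 * h ^ k)%C with (RtoC 0) by ring.
    rewrite Cmod_0. lra.
Qed.

Lemma equal_modulus_ray_sym f g p u : equal_modulus_ray f g p u -> equal_modulus_ray g f p u.
Proof. intros (s & Hs & H). exists s. split; auto. intros t Ht. symmetry. auto. Qed.

Lemma Cmod_sqr_plus (x y : C) :
  Cmod (x + y) ^ 2 = Cmod x ^ 2 + 2 * Re (Cconj x * y) + Cmod y ^ 2.
Proof. rewrite !Cmod2_alt. unfold Re, Im, Cconj. simpl. ring. Qed.

(** Write [X = c f] and [Y = g - c f].  Then [|X + Y| = |X|] on the ray, that is,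
    [2 Re (conj X * Y) = - |Y|^2].  The left-hand side has order [t^(k+m)] and the
    right-hand side order [t^(2m)], which is smaller because [k < m].  Hence the
    coefficient of [t^(k+m)] vanishes. *)
Lemma perturbation_orthogonal (f g : C -> C) (p c u : C) (k m : nat) (a d : C) :
  Cmod c = 1 -> (k < m)%nat -> equal_modulus_ray f g p u ->
  leading_term f p k a -> leading_term (fun z => g z - c * f z)%C p m d ->
  Re (Cconj (c * (a * u ^ k)) * (d * u ^ m)) = 0.
Proof.
  intros Hc Hkm (s & Hs & Hfg) Hf Hd.
  destruct (leading_term_ray f p u k a Hf) as (M1 & t1 & HM1 & Ht1 & H1).
  destruct (leading_term_ray _ p u m d Hd) as (M2 & t2 & HM2 & Ht2 & H2).
  cut (Rabs (Re (Cconj (c * (a * u ^ k)) * (d * u ^ m))) <= 0).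
  { intros H. apply Rabs_eq_0.
    generalize (Rabs_pos (Re (Cconj (c * (a * u ^ k)) * (d * u ^ m)))). lra. }
  apply coef_le_0_of_power_bound with (M2 * M2 + M1 * M2 + M1 * M2) (Rmin s (Rmin t1 t2)) (k
    + m)%nat.
  { repeat apply Rmin_pos; lra. }
  intros t Ht. assert (0 < t < s /\ t < t1 /\ t < t2) as (T0 & T1 & T2).
  { revert Ht. unfold Rmin. repeat destruct Rle_dec; lra. }
  destruct (H1 t ltac:(lra)) as (B1 & B2 & _). destruct (H2 t ltac:(lra)) as (D1 & D2 & D3).
  specialize (Hfg t T0).
  set (z := (p + t * u)%C) in *.
  (* [x] and [y] will be the leading parts of [X] and [Y]. *)
  set (X := (c * f z)%C). set (Y := (g z - c * f z)%C) in *.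
  set (x := (c * (a * u ^ k) * RtoC (t ^ k))%C). set (y := (d * u ^ m * RtoC (t ^ m))%C) in *.
  assert (EXY : 2 * Re (Cconj X * Y) = - Cmod Y ^ 2).
  { assert (S := Cmod_sqr_plus X Y). replace (X + Y)%C with (g z) in S by (unfold X, Y; ring).
    rewrite <- Hfg in S. unfold X at 1 in S. rewrite Cmod_mult, Hc, Rmult_1_l in S. lra. }
  assert (BX : Cmod X <= M1 * t ^ k) by (unfold X; rewrite Cmod_mult, Hc; lra).
  assert (BXx : Cmod (X - x) <= M1 * t ^ S k).
  { unfold X, x. replace (c * f z - c * (a * u ^ k) * RtoC (t ^ k))%C with (c *
    (f z - a * u ^ k * RtoC (t ^ k)))%C by ring.
    rewrite Cmod_mult, Hc. lra. }
  assert (Pk : 0 < t ^ k) by (apply pow_lt; lra). assert (Pm : 0 < t ^ m) by (apply pow_lt; lra).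
  assert (By : Cmod y <= M2 * t ^ m).
  { unfold y. rewrite !Cmod_mult, Cmod_pow, Cmod_R, Rabs_pos_eq by lra. apply Rmult_le_compat_r;
    lra. }
  assert (Exy : Rabs (Re (Cconj (c * (a * u ^ k)) * (d * u ^ m))) * t ^ (k + m) = Rabs (Re
    (Cconj x * y))).
  { rewrite pow_add. unfold x, y.
    rewrite <- (Rabs_pos_eq (t ^ k * t ^ m)) by (left; now apply Rmult_lt_0_compat).
    rewrite <- Rabs_mult. f_equal. rewrite <- re_scal_r. f_equal.
    rewrite RtoC_mult, (Cmult_conj (c * (a * u ^ k))).
    replace (Cconj (RtoC (t ^ k))) with (RtoC (t ^ k)) by (apply injective_projections; simpl;
      ring). ring. }
  rewrite Exy.
  replace (Cconj x * y)%C with (Cconj X * Y - (Cconj X * (Y - y) + Cconj (X - x) * y))%C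
    by (rewrite Cminus_conj; ring).
  unfold Cminus at 1. rewrite re_plus, re_opp.
  assert (N1 : Rabs (Re (Cconj X * Y)) <= M2 * M2 * t ^ S (k + m)).
  { replace (Re (Cconj X * Y)) with (- (Cmod Y ^ 2 / 2)) by lra.
    rewrite Rabs_Ropp, Rabs_pos_eq by (generalize (pow2_ge_0 (Cmod Y)); lra).
    assert (Y0 := Cmod_ge_0 Y).
    assert (Cmod Y ^ 2 <= (M2 * t ^ m) ^ 2) by (apply pow_incr; lra).
    assert (t ^ m * t ^ m <= t ^ S (k + m)).
    { replace m with (S k + (m - S k))%nat at 2 by lia.
      replace (S (k + m)) with (m + S k)%nat by lia. rewrite !pow_add.
      assert (0 <= t ^ (m - S k) <= 1).
      { split; [apply pow_le; lra|]. rewrite <- (pow1 (m - S k)). apply pow_incr; lra. }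
      assert (0 < t ^ S k) by (apply pow_lt; lra).
      apply Rmult_le_compat_l; [lra|]. rewrite <- (Rmult_1_r (t ^ S k)) at 2.
      apply Rmult_le_compat_l; lra. }
    assert (M2 * M2 * (t ^ m * t ^ m) <= M2 * M2 * t ^ S (k + m)) by (apply Rmult_le_compat_l;
      [nra|lra]).
    replace ((M2 * t ^ m) ^ 2) with (M2 * M2 * (t ^ m * t ^ m)) in H by ring.
    generalize (pow2_ge_0 (Cmod Y)). lra. }
  assert (N2 : Cmod (Cconj X * (Y - y)) <= M1 * M2 * t ^ S (k + m)).
  { rewrite Cmod_mult, Cmod_conj.
    replace (M1 * M2 * t ^ S (k + m)) with ((M1 * t ^ k) * (M2 * t ^ S m)) by (simpl;
      rewrite pow_add; ring).
    apply Rmult_le_compat; auto using Cmod_ge_0. }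
  assert (N3 : Cmod (Cconj (X - x) * y) <= M1 * M2 * t ^ S (k + m)).
  { rewrite Cmod_mult, Cmod_conj.
    replace (M1 * M2 * t ^ S (k + m)) with ((M1 * t ^ S k) * (M2 * t ^ m)) by (simpl;
      rewrite pow_add; ring).
    apply Rmult_le_compat; auto using Cmod_ge_0. }
  assert (N4 := Cmod_triangle (Cconj X * (Y - y)) (Cconj (X - x) * y)).
  assert (N5 := re_le_Cmod (Cconj X * (Y - y) + Cconj (X - x) * y)%C).
  eapply Rle_trans; [apply Rabs_triang|]. rewrite Rabs_Ropp. lra.
Qed.

(** * Rotation by an irrational angle *)
Lemma Cexpi_pow (alpha : R) (n : nat) : (Cexpi alpha ^ n)%C = Cexpi (INR n * alpha).
Proof.
  induction n as [|n IH].
  - simpl. unfold Cexpi. rewrite Rmult_0_l, cos_0, sin_0. reflexivity.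
  - rewrite Cpow_S, IH, S_INR. replace ((INR n + 1) * alpha) with (alpha + INR n * alpha) by ring.
    unfold Cexpi. rewrite cos_plus, sin_plus. apply injective_projections; simpl; ring.
Qed.

Lemma Cmod_Cexpi (alpha : R) : Cmod (Cexpi alpha) = 1.
Proof.
  unfold Cmod, Cexpi. cbn [fst snd].
  replace (cos alpha ^ 2 + sin alpha ^ 2) with 1; [apply sqrt_1|].
  generalize (sin2_cos2 alpha). unfold Rsqr. lra.
Qed.

Lemma sin_multiple_neq_0 (alpha : R) (n : nat) :
  ~ (exists q : Q, alpha = PI * Q2R q) -> (0 < n)%nat -> sin (INR n * alpha) <> 0.
Proof.
  intros Ha Hn Hs. apply sin_eq_0_0 in Hs. destruct Hs as [z Hz].
  apply Ha. exists (z # Pos.of_nat n)%Q. unfold Q2R. simpl.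
  rewrite <- (Nat2Pos.id n) in Hz at 1 by lia. rewrite INR_IPR in Hz.
  change (IPR (Pos.of_nat n)) with (IZR (Zpos (Pos.of_nat n))) in Hz.
  assert (Hp : 0 < IZR (Zpos (Pos.of_nat n))) by (apply IZR_lt; reflexivity).
  apply Rmult_eq_reg_l with (IZR (Zpos (Pos.of_nat n))); [|lra].
  rewrite Hz. field. lra.
Qed.

Theorem theorem2p1
  (Omega : C -> Prop)
  (Omega_open : open (T := C_UniformSpace) Omega)
  (Omega_connected : connected (T := C_UniformSpace) Omega)
  (f g : C -> C)
  (f_holo : holomorphic_on Omega f)
  (g_holo : holomorphic_on Omega g)
  (alpha : R)
  (alpha_irr : ~ exists q : Q, alpha = PI * Q2R q)
  (a b : C)
  (a_neq_b : a <> b)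
  (I_sub : forall z : C, segment a b z -> Omega z)
  (Ialpha_sub : forall z : C, rotated_segment a b alpha z -> Omega z)
  (mod_eq : forall z : C, segment a b z \/ rotated_segment a b alpha z ->
              Cmod (f z) = Cmod (g z)) :
  exists c : C, Cmod c = 1 /\ forall z : C, Omega z -> g z = (c * f z)%C.
Proof.
  set (p := midpoint a b). set (u := (b - a)%C).
  assert (Hu : u <> 0) by now apply Cminus_eq_contra, not_eq_sym.
  assert (Hseg : forall t, 0 < t < 1 / 2 -> segment a b (p + t * u)%C).
  { intros t Ht. exists (1 / 2 + t). split; [lra|]. unfold p, midpoint, u.
    apply injective_projections; simpl; field. }
  assert (Hp : Omega p).
  { apply I_sub. exists (1 / 2). split; [lra|]. unfold p, midpoint.
    apply injective_projections; simpl; field. }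
  assert (Ray1 : equal_modulus_ray f g p u).
  { exists (1 / 2). split; [lra|]. intros t Ht. apply mod_eq. left. now apply Hseg. }
  assert (Ray2 : equal_modulus_ray f g p (Cexpi alpha * u)).
  { exists (1 / 2). split; [lra|]. intros t Ht. apply mod_eq. right.
    exists (p + t * u)%C. split; [now apply Hseg|]. unfold rotation. fold p. ring. }
  assert (Hray : forall t, 0 < t < 1 / 2 ->
    Omega (p + t * u)%C /\ Cmod (f (p + t * u)%C) = Cmod (g (p + t * u)%C)).
  { intros t Ht. split; [now apply I_sub, Hseg|]. apply mod_eq. left. now apply Hseg. }
  destruct (identity_theorem Omega f Omega_open Omega_connected f_holo) as [F0|F];
  destruct (identity_theorem Omega g Omega_open Omega_connected g_holo) as [G0|G].
  - exists 1. split; [apply Cmod_1|]. intros z Hz. rewrite F0, G0 by auto. ring.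
  - exfalso. destruct (G p Hp) as (m & b' & Hb & Lg).
    apply (leading_term_ray_neq_0 g p u m b' (1 / 2) Hu Hb Lg); [lra|].
    intros t Ht. destruct (Hray t Ht) as [Hz E]. apply Cmod_eq_0. rewrite <- E, F0 by auto.
    apply Cmod_0.
  - exfalso. destruct (F p Hp) as (k & a' & Ha & Lf).
    apply (leading_term_ray_neq_0 f p u k a' (1 / 2) Hu Ha Lf); [lra|].
    intros t Ht. destruct (Hray t Ht) as [Hz E]. apply Cmod_eq_0. rewrite E, G0 by auto.
    apply Cmod_0.
  - destruct (F p Hp) as (k & a' & Ha & Lf). destruct (G p Hp) as (m & b' & Hb & Lg).
    assert (m = k) as ->.
    { apply Nat.le_antisymm.
      - exact (leading_term_order_le f g p u k m a' b' Hu Ray1 Ha Lf Lg).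
      - exact (leading_term_order_le g f p u m k b' a' Hu
        (equal_modulus_ray_sym _ _ _ _ Ray1) Hb Lg Lf). }
    assert (Eab : Cmod a' = Cmod b').
    { apply Rle_antisym.
      - exact (leading_coef_modulus_le f g p u k a' b' Hu Ray1 Lf Lg).
      - exact (leading_coef_modulus_le g f p u k b' a' Hu
        (equal_modulus_ray_sym _ _ _ _ Ray1) Lg Lf). }
    set (c := (b' / a')%C).
    assert (Hc : Cmod c = 1).
    { unfold c. rewrite Cmod_div by auto. rewrite Eab. field. apply Cmod_gt_0 in Hb. lra. }
    exists c. split; auto.
    assert (D_holo : holomorphic_on Omega (fun z => g z - c * f z)%C).
    { apply (holomorphic_on_minus _ g (fun z => c * f z)%C g_holo).
      exact (holomorphic_on_mult _ (fun _ => c) f (holomorphic_on_const _ c) f_holo). }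
    destruct (identity_theorem Omega _ Omega_open Omega_connected D_holo) as [D0|D].
    { intros z Hz. apply Ceq_minus. exact (D0 z Hz). }
    exfalso. destruct (D p Hp) as (m & d & Hd & Ld).
    assert (Lk : leading_term (fun z => g z - c * f z)%C p k 0).
    { replace (RtoC 0) with (b' - c * a')%C by (unfold c; field; auto).
      now apply leading_term_minus. }
    (* The difference has coefficient [0] at order [k], hence at every order up to [k]:
       comparing it with itself excludes [m <= k]. *)
    assert (Hkm : (k < m)%nat).
    { destruct (Nat.le_gt_cases m k) as [Hmk|]; auto. exfalso. apply Hd, Cmod_le_0.
      rewrite <- Cmod_0.
      apply (leading_coef_modulus_le (fun z => g z - c * f z)%C (fun z
        => g z - c * f z)%C p u m d 0 Hu); auto.
      - exists 1. split; [lra|]. reflexivity.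
      - destruct (Nat.eq_dec m k) as [->|]; auto. apply (leading_term_lower _ p m k 0);
        [lia|exact Lk]. }
    assert (P1 := perturbation_orthogonal f g p c u k m a' d Hc Hkm Ray1 Lf Ld).
    assert (P2 := perturbation_orthogonal f g p c (Cexpi alpha * u) k m a' d Hc Hkm Ray2 Lf Ld).
    (* Turning [u] by [alpha] multiplies [W] by [conj (e^(i k alpha)) e^(i m alpha)],
       which is [e^(i (m - k) alpha)]. *)
    set (W := (Cconj (c * (a' * u ^ k)) * (d * u ^ m))%C) in P1.
    assert (HW : W <> 0).
    { assert (Hc0 : c <> 0) by (apply Cmod_gt_0; lra).
      unfold W. apply Cmod_gt_0. rewrite Cmod_mult, Cmod_conj.
      apply Rmult_lt_0_compat; apply Cmod_gt_0; auto using Cmult_neq_0, Cpow_nz. }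
    replace (Cconj (c * (a' * (Cexpi alpha * u) ^ k)) * (d * (Cexpi alpha * u) ^ m))%C
      with (W * Cexpi (INR (m - k) * alpha))%C in P2.
    + rewrite re_mult, P1 in P2.
      assert (Hs := sin_multiple_neq_0 alpha (m - k) alpha_irr ltac:(lia)).
      apply HW. apply injective_projections; [exact P1|].
      change (Im W = 0). change (0 * cos (INR (m - k) * alpha) - Im W * sin (INR
        (m - k) * alpha) = 0) in P2.
      apply Rmult_eq_reg_r with (sin (INR (m - k) * alpha)); auto. lra.
    + assert (Hm : (Cexpi alpha ^ k * Cconj (Cexpi alpha ^ k))%C = 1).
      { rewrite <- Cmod2_conj, Cmod_pow, Cmod_Cexpi, !pow1. reflexivity. }
      rewrite <- Cexpi_pow. unfold W.
      rewrite !Cpow_mult_l, !Cmult_conj.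
      replace (Cexpi alpha ^ m)%C with (Cexpi alpha ^ k * Cexpi alpha ^ (m - k))%C
        by (rewrite <- Cpow_add_r; f_equal; lia).
      transitivity (Cconj c * Cconj a' * Cconj (u ^ k) * d * u ^ m * Cexpi alpha ^ (m - k) *
        (Cexpi alpha ^ k * Cconj (Cexpi alpha ^ k)))%C; [rewrite Hm|]; ring.
Qed.
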